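(* (i) For infinitely many $n$, one has $$f(n)\geq \exp \left((\log 3 +o(1))\frac{\log n}{\log \log n}\right),$$ where $o(1)$ denotes a quantity that goes to zero as $n \to \infty$. (ii) For any function $\xi(n)$ going to $+\infty$ as $n \to \infty$, one has $$f(n)\geq \exp \left( \frac{\log 3}{2}\log \log n - O\left(\xi(n) \sqrt{\log \log n}\right)\right) \gg (\log n)^{0.549}$$ for all $n$ in a subset $A$ of natural numbers of density $1$ (thus $|A \cap \{1,\ldots,N\}|/N \to 1$ as $N \to \infty$). (iii) One has $$f(p)\geq \exp \left( \left(\frac{\log 3}{2} - o(1)\right) \log \log p \right) \gg (\log p)^{0.549}$$ for all primes $p$ in a subset $B$ of primes of relative density $1$ (thus $|\{ p \in B: p \leq N\}|/|\{ p: p \leq N \}| \to 1$ as $N \to \infty$, where in the denominator $p$ ranges over all primes).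
   Context: $\mathbb{N} = \{1,2,\ldots\}$ is the set of natural numbers. For $n \in \mathbb{N}$, $f(n)$ denotes the number of solutions $(x,y,z) \in \mathbb{N}^3$ to the equation $\frac{4}{n} = \frac{1}{x}+\frac{1}{y}+\frac{1}{z}$ (ordered triples; $x,y,z$ are not assumed to be distinct or in increasing order). The notation $X = O(Y)$ or $X \ll Y$ means $|X| \leq CY$ for an absolute constant $C$, and $X \gg Y$ means $Y \ll X$. In (iii), $o(1)$ denotes a quantity that goes to zero as $p \to \infty$. *)

(* Defs.v *)
From HB Require Import structures.
From mathcomp Require Import all_boot all_order all_algebra.
From mathcomp Require Import finmap zify ring.
From mathcomp Require Import all_classical all_reals all_analysis.

Set Implicit Arguments.
Unset Strict Implicit.
Unset Printing Implicit Defensive.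

Import Order.TTheory GRing.Theory Num.Theory.
Import numFieldNormedType.Exports.

Local Open Scope classical_set_scope.
Local Open Scope ring_scope.

Definition es_solutions (n : nat) : set (nat * nat * nat) :=
  [set t : nat * nat * nat | let: (x, y, z) := t in
    [/\ (0 < x)%N, (0 < y)%N, (0 < z)%N &
        4%:R / n%:R = x%:R^-1 + y%:R^-1 + z%:R^-1 :> rat]].

(* Ordered triples. [fset_set] is empty on infinite sets, so this is the true
   count thanks to [finite_es_solutions] below. *)
Definition es_count (n : nat) : nat := #|` fset_set (es_solutions n)|.

Lemma es_solutions_natE (n x y z : nat) : es_solutions n (x, y, z) ->
  [/\ (0 < x)%N, (0 < y)%N, (0 < z)%N &
      (4 * x * y * z = n * (y * z + x * z + x * y))%N].
Proof.
case=> x0 y0 z0 e; split => //.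
have [n0|n0] := posnP n.
  have : (0 : rat) < x%:R^-1 + y%:R^-1 + z%:R^-1.
    by rewrite !addr_gt0 // invr_gt0 ltr0n.
  by rewrite -e n0 invr0 mulr0 ltxx.
have ne k : (0 < k)%N -> (k%:R : rat) != 0 by rewrite pnatr_eq0 -lt0n.
have /= hx := ne _ x0; have /= hy := ne _ y0; have /= hz := ne _ z0.
have /= hn := ne _ n0.
apply/eqP; rewrite -(eqr_nat rat) !(natrM, natrD); apply/eqP.
transitivity ((4%:R / n%:R) * (n%:R * x%:R * y%:R * z%:R) : rat).
  by field.
by rewrite e; field; rewrite hx hy hz.
Qed.

Lemma es_sorted_bound (n x y z : nat) :
  (0 < x)%N -> (x <= y)%N -> (y <= z)%N ->
  (4 * x * y * z = n * (y * z + x * z + x * y))%N ->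
  (z <= n * (3 * n) * (2 * n * (3 * n)))%N.
Proof.
move=> x0 xy yz e.
have yz0 : (0 < y * z)%N by rewrite muln_gt0; lia.
have z0 : (0 < z)%N by lia.
have xzyz : (x * z <= y * z)%N by rewrite leq_mul2r xy orbT.
have xyyz : (x * y <= y * z)%N by rewrite mulnC leq_mul2l (leq_trans xy yz) orbT.
have xyxz : (x * y <= x * z)%N by rewrite leq_mul2l yz orbT.
have n0 : (0 < n)%N by case: n e => // e; nia.
have hx : (4 * x <= 3 * n)%N.
  rewrite -(leq_pmul2r yz0).
  have -> : (4 * x * (y * z) = 4 * x * y * z)%N by rewrite !mulnA.
  by rewrite e (mulnC 3) -mulnA leq_mul2l; lia.
have hn : (n < 4 * x)%N.
  rewrite -(ltn_pmul2r yz0).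
  have -> : (4 * x * (y * z) = 4 * x * y * z)%N by rewrite !mulnA.
  rewrite e ltn_pmul2l //.
  have : (0 < x * y)%N by rewrite muln_gt0; lia.
  lia.
have hy : (y <= 2 * n * x)%N.
  have k : ((4 * x - n) * y * z <= 2 * n * x * z)%N by nia.
  rewrite leq_pmul2r // in k; nia.
have hz : (z <= n * x * y)%N.
  have : (((4 * x - n) * y - n * x) * z = n * x * y)%N by nia.
  have : (0 < n * x * y)%N by nia.
  by case: (_ - _)%N => [|k]; nia.
have x3 : (x <= 3 * n)%N by lia.
apply: (leq_trans hz); apply: leq_mul; first by rewrite leq_mul2l x3 orbT.
by apply: (leq_trans hy); rewrite leq_mul2l x3 orbT.
Qed.

Lemma finite_es_solutions (n : nat) : finite_set (es_solutions n).
Proof.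
pose B := (n * (3 * n) * (2 * n * (3 * n))).+1%N.
apply: (@sub_finite_set _ _ (`I_B `*` `I_B `*` `I_B)); last first.
  by do 2?[apply: finite_setX]; exact: finite_II.
move=> [[x y] z] /es_solutions_natE [x0 y0 z0 e] /=.
rewrite /B !ltnS.
have S := @es_sorted_bound n.
have [xy|/ltnW xy] := leqP x y; have [yz|/ltnW yz] := leqP y z;
  have [xz|/ltnW xz] := leqP x z.
- by have := S x y z x0 xy yz e; lia.
- by have := S x y z x0 xy yz e; lia.
- by have := S x z y x0 xz yz ltac:(lia); lia.
- by have := S z x y z0 xz xy ltac:(lia); lia.
- by have := S y x z y0 xy xz ltac:(lia); lia.
- by have := S y z x y0 yz xz ltac:(lia); lia.
- by have := S z y x z0 yz xy ltac:(lia); lia.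
- by have := S z y x z0 yz xy ltac:(lia); lia.
Qed.

(* |A `&` {1, ..., N}| *)
Definition count_upto (A : set nat) (N : nat) : nat :=
  (\sum_(1 <= n < N.+1 | n \in A) 1)%N.

Definition density_one (R : realType) (A : set nat) : Prop :=
  (count_upto A N)%:R / N%:R @[N --> \oo] --> (1 : R).

Definition relative_density_one (R : realType) (A P : set nat) : Prop :=
  (count_upto A N)%:R / (count_upto P N)%:R @[N --> \oo] --> (1 : R).

(* [ln] is 0 on nonpositive reals, so this is a junk value for n <= 1. *)
Definition loglog (R : realType) (n : nat) : R := ln (ln n%:R).

(* Main.v *)
(** Write [4/n = 1/x + a/M]. If [d] divides [M^2] and [a] divides both [M + d] and
    [M + M^2/d], then [a/M] is the sum of the reciprocals of [(M + d)/a] and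
    [(M + M^2/d)/a], so [f(n)] is at least the number of such [d]. One can take
    [a = 1] and [M = n/2], [n] or [n(n+1)/4] when [n] is even, divisible by [3] or
    [3 mod 4], and [a = 3], [M = n(n+3)/4] when [n] is [1 mod 4]. For [a = 1] every
    [d] works; for [a = 3] the condition is [d = 2 mod 3], which a prime factor [2 mod 3]
    of [M] allows one to arrange. Hence [f(n) >= 3^(omega(M) - 1)] as soon as, in the
    last case, [M] has a prime factor [2 mod 3].

    Primorials and Chebyshev's bounds give (i). For (ii) and (iii), [omega] has normal
    order [ln ln n], twice what is needed, so the error terms can be taken to be [0],
    and crude bounds on the exceptional sets suffice. Integers [n <= N] such that [n]
    has few prime factors, or none that is [2 mod 3], are counted by Brun's pure sieve
    with the weight [(2/3)^omega] in place of an indicator. Primes [p <= N] such that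
    [p + 1] or [p + 3] is of this kind are counted by sieving [p] at the same time;
    there are [O(N (ln N)^(-1-c))] of them, which is negligible against Chebyshev's
    lower bound for the number of primes. *)

Require Import Defs.
From HB Require Import structures.
From mathcomp Require Import all_boot all_order all_algebra.
From mathcomp Require Import all_classical all_reals all_analysis.
From mathcomp Require Import finmap zify ring lra.

Set Implicit Arguments.
Unset Strict Implicit.
Unset Printing Implicit Defensive.

Import Order.TTheory GRing.Theory Num.Theory.
Import numFieldNormedType.Exports.

Local Open Scope classical_set_scope.
Local Open Scope ring_scope.

(** * Unit fractions from divisors *)

(** The hypothesis [4 * x * M = n * (M + a * x)] is [4/n = 1/x + a/M] cleared of denominators. If
    [M^2 = d e'], then [(M + d)(M + e') = M (2 M + d + e')], so [a/(M + d) + a/(M + e') = a/M]. *)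
Lemma es_solutions_split (n x M a d : nat) :
  (0 < n)%N -> (0 < x)%N -> (0 < M)%N -> (0 < a)%N ->
  (4 * x * M = n * (M + a * x))%N ->
  (d %| M ^ 2)%N -> (a %| M + d)%N -> (a %| M + M ^ 2 %/ d)%N ->
  es_solutions n (x, (M + d) %/ a, (M + M ^ 2 %/ d) %/ a)%N.
Proof.
move=> n0 x0 M0 a0 e /dvdnP[e' Me] ad ae.
have d0 : (0 < d)%N by case: d Me {ad ae} => // Me; nia.
have e0 : (0 < e')%N by case: e' Me => // Me; nia.
have ee : (M ^ 2 %/ d = e')%N by rewrite Me mulnK.
rewrite ee in ae *.
have ne k : (0 < k)%N -> (k%:R : rat) != 0 by rewrite pnatr_eq0 -lt0n.
have div_natr u : (a %| u)%N -> ((u %/ a)%N%:R : rat) = u%:R / a%:R.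
  by move=> au; apply: (canRL (mulfK (ne _ a0))); rewrite -natrM divnK.
split=> //; rewrite ?divn_gt0 //.
- by apply: dvdn_leq => //; lia.
- by apply: dvdn_leq => //; lia.
rewrite !div_natr // !natrD.
have /= hn := ne _ n0; have /= hx := ne _ x0; have /= hM := ne _ M0.
have /= ha := ne _ a0.
have hMd : (M%:R + d%:R : rat) != 0 by rewrite -natrD ne //; lia.
have hMe : (M%:R + e'%:R : rat) != 0 by rewrite -natrD ne //; lia.
have Me' : M%:R ^+ 2 = e'%:R * d%:R :> rat by rewrite -natrM -Me natrX.
rewrite -addrA; have -> : ((M%:R + d%:R) / a%:R)^-1 + ((M%:R + e'%:R) / a%:R)^-1
    = a%:R / M%:R :> rat.
  by field: Me'; rewrite ha hM hMd hMe.
have e2 : 4 * x%:R * M%:R = n%:R * (M%:R + a%:R * x%:R) :> rat.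
  by rewrite -!(natrM, natrD) e.
by field: e2; rewrite hM hn hx.
Qed.

(** As [a] divides [M + d], the second coordinate determines [d], and distinct divisors give
    distinct triples. *)
Lemma es_count_ge (n x M a : nat) (D : seq nat) :
  (0 < n)%N -> (0 < x)%N -> (0 < M)%N -> (0 < a)%N ->
  (4 * x * M = n * (M + a * x))%N -> uniq D ->
  {in D, forall d, [/\ d %| M ^ 2, a %| M + d & a %| M + M ^ 2 %/ d]%N} ->
  (size D <= es_count n)%N.
Proof.
move=> n0 x0 M0 a0 e uD hD.
pose f d := (x, (M + d) %/ a, (M + M ^ 2 %/ d) %/ a)%N.
rewrite -(size_map f); apply: uniq_leq_size.
  rewrite map_inj_in_uniq // => d d' /hD[_ ad _] /hD[_ ad' _] [+ _].
  by move/(congr1 (muln^~ a)); rewrite /= !divnK // => /addnI.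
move=> _ /mapP[d /hD[dM ad ae] ->].
rewrite in_fset_set; last exact: finite_es_solutions.
by apply/mem_set; exact: es_solutions_split.
Qed.

(** Each prime of [S] occurs with exponent 0, 1 or 2, whence three choices per prime. *)
Lemma prime_seq_divisors (S : seq nat) : uniq S -> all prime S ->
  exists D : seq nat, [/\ uniq D, size D = (3 ^ size S)%N &
    {in D, forall d, d %| (\prod_(l <- S) l) ^ 2}%N].
Proof.
elim: S => [|l S IH] /=.
  by move=> _ _; exists [:: 1%N]; split=> // d; rewrite inE => /eqP ->.
move=> /andP[lS uS] /andP[pl pS]; have [D [uD sD hD]] := IH uS pS.
(* This keeps [D], [l D] and [l^2 D] disjoint. *)
have lD d : d \in D -> ~~ (l %| d)%N.
  move=> /hD dS; apply/negP => /dvdn_trans/(_ dS).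
  rewrite Euclid_dvdX // andbT big_seq.
  elim/big_ind: _ => [|u v hu hv|m mS].
  - by rewrite dvdn1; case: eqP pl => // ->.
  - by rewrite Euclid_dvdM // => /orP[].
  - by rewrite dvdn_prime2 // ?(allP pS) // => /eqP lm; rewrite lm mS in lS.
have l0 := prime_gt0 pl.
exists (D ++ map (muln l) D ++ map (muln (l ^ 2)) D); split.
- have inj k : (0 < k)%N -> injective (muln k).
    by move=> k0 u v /eqP; rewrite eqn_pmul2l // => /eqP.
  rewrite !cat_uniq uD !map_inj_uniq ?uD //=; try by apply: inj; lia.
  rewrite has_cat negb_or andbT -andbA; apply/and3P; split.
  + by apply/hasPn => _ /mapP[d dD ->]; apply/negP => /lD; rewrite dvdn_mulr.
  + apply/hasPn => _ /mapP[d dD ->]; apply/negP => /lD.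
    by rewrite expnS -mulnA dvdn_mulr.
  + apply/hasPn => _ /mapP[d dD ->]; apply/negP => /mapP[d' /lD].
    rewrite expnS expn1 -mulnA => ld' /eqP; rewrite eqn_pmul2l // => /eqP dE.
    by rewrite -dE dvdn_mulr in ld'.
- by rewrite !size_cat !size_map sD expnS; lia.
- move=> d; rewrite big_cons expnMn !mem_cat => /or3P[/hD h|/mapP[d' /hD h ->]|
    /mapP[d' /hD h ->]].
  + by rewrite dvdn_mull.
  + by apply: dvdn_mul => //; rewrite expnS dvdn_mulr.
  + exact: dvdn_mul.
Qed.

Lemma prime_seq_prod_dvd (S : seq nat) (M : nat) : uniq S -> all prime S ->
  {in S, forall l, l %| M}%N -> (\prod_(l <- S) l %| M)%N.
Proof.
elim: S => [|l S IH] /=; first by rewrite big_nil dvd1n.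
move=> /andP[lS uS] /andP[pl pS] h; rewrite big_cons Gauss_dvd.
  rewrite h ?mem_head //=; apply: IH => // m mS.
  by rewrite h // inE mS orbT.
rewrite big_seq; elim/big_ind: _ => [|u v hu hv|m mS].
- by rewrite coprimen1.
- by rewrite coprimeMr hu.
- rewrite prime_coprime // dvdn_prime2 // ?(allP pS) //.
  by apply: contraNN lS => /eqP ->.
Qed.

Lemma prime_divisors (S : seq nat) (M : nat) : uniq S -> all prime S ->
  {in S, forall l, l %| M}%N ->
  exists D : seq nat, [/\ uniq D, size D = (3 ^ size S)%N,
    {in D, forall d, d %| M ^ 2}%N &
    forall q, prime q -> q \notin S -> {in D, forall d, ~~ (q %| d)%N}].
Proof.
move=> uS pS hS; have [D [uD sD hD]] := prime_seq_divisors uS pS.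
exists D; split=> //.
  by move=> d /hD /dvdn_trans; apply; rewrite dvdn_exp2r // prime_seq_prod_dvd.
move=> q pq qS d /hD dS; apply/negP => /dvdn_trans/(_ dS).
rewrite Euclid_dvdX // andbT big_seq; apply/negP.
elim/big_ind: _ => [|u v hu hv|m mS].
- by rewrite dvdn1; case: eqP pq => // ->.
- by rewrite Euclid_dvdM // negb_or hu.
- by rewrite dvdn_prime2 // ?(allP pS) //; apply: contraNneq qS => ->.
Qed.

Lemma es_count_ge_pow3 (n x M : nat) (S : seq nat) :
  (0 < n)%N -> (0 < x)%N -> (0 < M)%N -> (4 * x * M = n * (M + x))%N ->
  uniq S -> all prime S -> {in S, forall l, l %| M}%N ->
  (3 ^ size S <= es_count n)%N.
Proof.
move=> n0 x0 M0 e uS pS hS; have [D [uD <- hD _]] := prime_divisors uS pS hS.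
apply: (@es_count_ge n x M 1) => //; first by rewrite mul1n.
by move=> d /hD; rewrite !dvd1n.
Qed.

(** [4/n = 2/n + 2/n], and a prime [l > 3] dividing [n] divides [n/2]. *)
Lemma es_count_even (n : nat) (S : seq nat) : (0 < n)%N -> ~~ odd n ->
  uniq S -> all (fun l => prime l && (3 < l)%N) S -> {in S, forall l, l %| n}%N ->
  (3 ^ size S <= es_count n)%N.
Proof.
move=> n0 on uS pS hS; have en : n = (2 * n./2)%N by rewrite mul2n even_halfK.
apply: (@es_count_ge_pow3 n n./2 n./2) => //; try lia.
  by apply: sub_all pS => l /andP[].
move=> l lS; have /andP[pl l3] := allP pS _ lS.
by have := hS _ lS; rewrite {1}en Euclid_dvdM // gtnNdvd //; lia.
Qed.

Lemma es_count_dvd3 (n : nat) (S : seq nat) : (0 < n)%N -> (3 %| n)%N ->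
  uniq S -> all prime S -> {in S, forall l, l %| n}%N ->
  (3 ^ size S <= es_count n)%N.
Proof.
move=> n0 /dvdnP[m en] uS pS hS.
by apply: (@es_count_ge_pow3 n m n) => //; lia.
Qed.

(** [4/n - 4/(n + 1) = 4/(n (n + 1))], and 4 divides [n + 1]. *)
Lemma es_count_3mod4 (n : nat) (S : seq nat) : (n %% 4 = 3)%N ->
  uniq S -> all (fun l => prime l && (3 < l)%N) S ->
  {in S, forall l, l %| n * (n + 1)}%N ->
  (3 ^ size S <= es_count n)%N.
Proof.
move=> n4 uS pS hS; have en : (n + 1 = 4 * ((n + 1) %/ 4))%N by lia.
apply: (@es_count_ge_pow3 n ((n + 1) %/ 4) (n * ((n + 1) %/ 4))) => //; try nia.
  by apply: sub_all pS => l /andP[].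
move=> l lS; have /andP[pl l3] := allP pS _ lS.
have := hS _ lS; rewrite {1}en mulnCA Euclid_dvdM // => /orP[|//].
by rewrite (_ : 4 = 2 ^ 2)%N // Euclid_dvdX // gtnNdvd //; lia.
Qed.

(** [4/n - 1/x = 3/(n x)] for [x = (n + 3)/4]. The prime [q] is set aside and [D] is built from the
    other primes of [S], which accounts for [(size S).-1]. *)
Lemma es_count_1mod4 (n q : nat) (S : seq nat) :
  (n %% 4 = 1)%N -> ~~ (3 %| n)%N ->
  prime q -> (q %% 3 = 2)%N -> (2 < q)%N -> (q %| n * (n + 3))%N ->
  uniq S -> all (fun l => prime l && (3 < l)%N) S ->
  {in S, forall l, l %| n * (n + 3)}%N ->
  (3 ^ (size S).-1 <= es_count n)%N.
Proof.
move=> n4 n3 pq q3 q2 qn uS pS hS.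
have en : (n + 3 = 4 * ((n + 3) %/ 4))%N by lia.
set x := ((n + 3) %/ 4)%N in en.
have hM l : prime l -> (2 < l)%N -> (l %| n * (n + 3))%N -> (l %| n * x)%N.
  move=> pl l2; rewrite {1}en mulnCA Euclid_dvdM // => /orP[|//].
  by rewrite (_ : 4 = 2 ^ 2)%N // Euclid_dvdX // gtnNdvd //; lia.
have qM := hM _ pq q2 qn.
have [|||D [uD sD hD cD]] := @prime_divisors [seq l <- S | l != q] (n * x).
- by rewrite filter_uniq.
- by apply/allP => l; rewrite mem_filter => /andP[_] /(allP pS) /andP[].
- move=> l; rewrite mem_filter => /andP[_ lS].
  by have /andP[pl l3] := allP pS _ lS; apply: hM (hS _ lS); lia.
have qD : {in D, forall d, ~~ (q %| d)%N} by apply: cD; rewrite // mem_filter /= eqxx.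
have D3 : {in D, forall d, ~~ (3 %| d)%N}.
  apply: cD => //; rewrite mem_filter negb_and orbC.
  by case: (boolP (3%N \in S)) => // /(allP pS).
have sS : ((size S).-1 <= size [seq l <- S | l != q])%N.
  rewrite size_filter; have := count_predC (pred1 q) S.
  rewrite count_uniq_mem //; case: (q \in S) => /=;
    rewrite -[count (predC _) S]/(count (fun l => l != q) S); lia.
apply: leq_trans (leq_pexp2l _ sS) _ => //; rewrite -sD.
(* Multiplication by [q] turns the divisors that are [1 mod 3] into [2 mod 3]; [f] is injective on
   [D], where nothing is divisible by [q]. *)
pose f d := if (d %% 3 == 1)%N then (d * q)%N else d.
have q0 := prime_gt0 pq.
rewrite -(size_map f).
have n0 : (0 < n)%N by lia.
have x0 : (0 < x)%N by lia.
(* [4 x = n + 3] gives [x = n mod 3], so [n x] is a nonzero square mod 3. *)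
have M3 : (n * x %% 3 = 1)%N.
  have h1 : (x %% 3 = n %% 3)%N by lia.
  rewrite -modnMml -modnMmr h1.
  have : (n %% 3 = 1 \/ n %% 3 = 2)%N by move: n3; rewrite /dvdn; lia.
  by case=> ->.
apply: (@es_count_ge n x (n * x) 3); rewrite ?muln_gt0 ?n0 //.
- by rewrite -en; ring.
- rewrite map_inj_in_uniq // => d d' dD d'D; rewrite /f.
  case: ifP => _; case: ifP => _ //.
  + by move=> /eqP; rewrite eqn_pmul2r // => /eqP.
  + by move=> h; have := qD _ d'D; rewrite -h dvdn_mull.
  + by move=> h; have := qD _ dD; rewrite h dvdn_mull.
- move=> _ /mapP[d dD ->].
  have fM : (f d %| (n * x) ^ 2)%N.
    rewrite /f; case: ifP => _; last exact: hD.
    have cdq : coprime d q by rewrite coprime_sym prime_coprime // qD.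
    by rewrite Gauss_dvd // hD // dvdn_exp.
  have f3 : (f d %% 3 = 2)%N.
    rewrite /f; case: ifP => [/eqP h|h]; first by rewrite -modnMm h q3.
    by have := D3 _ dD; move: h; rewrite /dvdn; lia.
  split=> //; first by rewrite /dvdn -modnDm M3 f3.
  have /dvdnP[e eM] := fM.
  have fd0 : (0 < f d)%N by case: (f d) f3.
  rewrite eM mulnK //.
  have : (e * f d %% 3 = 1)%N by rewrite -eM expnS expn1 -modnMm M3.
  rewrite -modnMm f3 => h.
  rewrite /dvdn -modnDm M3.
  have : (e %% 3 < 3)%N by rewrite ltn_mod.
  by move: h; case: (e %% 3)%N => [|[|[|]]].
Qed.

(** * Brun's pure sieve *)

Section Sieve.
Variable R : realType.
Implicit Types (a : nat -> R) (s : seq nat).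

(* [bonf a s r] is the sum over [j <= r] of [(-1)^j] times the [j]-th elementary
   symmetric function of the [a l], [l \in s]. *)
Fixpoint bonf a s r : R :=
  match s, r with
  | l :: s', r'.+1 => bonf a s' r - a l * bonf a s' r'
  | _, _ => 1
  end.

Lemma bonfS a l s r : bonf a (l :: s) r.+1 = bonf a s r.+1 - a l * bonf a s r.
Proof. by []. Qed.

Lemma prod_subr_itv01 a s : {in s, forall l, 0 <= a l <= 1} ->
  0 <= \prod_(l <- s) (1 - a l) <= 1.
Proof.
move=> ha; rewrite big_seq; elim/big_ind: _ => [|x y|l /ha]; [lra|nra|lra].
Qed.

(** By [bonfS], the error for [l :: s] at order [r + 1] is the error for [s] at order [r + 1] minus
    [a l] times that at order [r]. These two have opposite signs, so the sign alternates with
    [r]. *)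
Lemma bonf_bonferroni a s r : {in s, forall l, 0 <= a l <= 1} ->
  if odd r then bonf a s r <= \prod_(l <- s) (1 - a l)
  else \prod_(l <- s) (1 - a l) <= bonf a s r.
Proof.
elim: s r => [|l s IH] r ha; first by rewrite big_nil /=; case: odd; case: r.
have ha' : {in s, forall l, 0 <= a l <= 1}.
  by move=> m ms; apply: ha; rewrite inE ms orbT.
have al : 0 <= a l <= 1 by apply: ha; rewrite mem_head.
case: r => [|r] /=; first by case/andP: (prod_subr_itv01 ha).
rewrite big_cons; have := IH r ha'; have := IH r.+1 ha'; rewrite /=.
by case: (odd r) => /=; nra.
Qed.

Lemma exprD_ge2 (x y : R) k : 0 <= x -> 0 <= y ->
  x ^+ k.+1 + k.+1%:R * y * x ^+ k <= (x + y) ^+ k.+1.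
Proof.
move=> x0 y0; elim: k => [|k IH]; first by rewrite !expr1 expr0; lra.
rewrite (exprS (x + y)).
apply: le_trans (_ : (x + y) * (x ^+ k.+1 + k.+1%:R * y * x ^+ k) <= _); last first.
  by rewrite ler_wpM2l // addr_ge0.
have xk := exprn_ge0 k x0.
rewrite !exprS -[k.+2%:R]natr1.
have : 0 <= k.+1%:R * y * y * x ^+ k :> R by rewrite !mulr_ge0.
nra.
Qed.

(** The right-hand side bounds the first omitted elementary symmetric function. The errors obey the
    recurrence of [bonf], and the bound is stable under it by [exprD_ge2]. *)
Lemma bonf_dist a s r : {in s, forall l, 0 <= a l <= 1} ->
  `|bonf a s r - \prod_(l <- s) (1 - a l)|
    <= (\sum_(l <- s) a l) ^+ r.+1 / (r.+1)`!%:R.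
Proof.
elim: s r => [|l s IH] r ha.
  by rewrite !big_nil; case: r => [|r]; rewrite /= subrr normr0 expr0n mul0r.
have ha' : {in s, forall l, 0 <= a l <= 1}.
  by move=> m ms; apply: ha; rewrite inE ms orbT.
have al : 0 <= a l <= 1 by apply: ha; rewrite mem_head.
have S0 : 0 <= \sum_(l <- s) a l.
  by rewrite big_seq sumr_ge0 // => m /ha' /andP[].
have P01 := prod_subr_itv01 ha'.
have := IH^~ ha'; rewrite !big_cons.
set S := \sum_(l <- s) a l in S0 *; set P := \prod_(l <- s) _ in P01 *.
case: r => [|r] IHs.
  have := IHs 0%N; have -> : bonf a s 0 = 1 by case: (s).
  rewrite (_ : 1`! = 1)%N // !expr1 !divr1 => h.
  have -> : bonf a (l :: s) 0 - (1 - a l) * P = 1 - P + a l * P by rewrite /=; ring.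
  by apply: le_trans (ler_normD _ _) _; rewrite [X in _ + X]ger0_norm; nra.
rewrite bonfS.
have -> : bonf a s r.+1 - a l * bonf a s r - (1 - a l) * P =
    (bonf a s r.+1 - P) - a l * (bonf a s r - P) by ring.
apply: le_trans (ler_normB _ _) _; rewrite normrM (ger0_norm (_ : 0 <= a l)); last lra.
apply: le_trans (lerD (IHs _) (_ : _ <= a l * (S ^+ r.+1 / (r.+1)`!%:R))) _.
  by rewrite ler_wpM2l //; lra.
have f0 : 0 < (r.+2)`!%:R :> R by rewrite ltr0n fact_gt0.
rewrite ler_pdivlMr //.
have -> : (S ^+ r.+2 / (r.+2)`!%:R + a l * (S ^+ r.+1 / (r.+1)`!%:R)) * (r.+2)`!%:R =
    S ^+ r.+2 + r.+2%:R * a l * S ^+ r.+1.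
  rewrite factS natrM; field.
  by rewrite -natrD !pnatr_eq0 -lt0n fact_gt0.
by rewrite (addrC (a l)); apply: exprD_ge2 => //; lra.
Qed.

Definition periodic (d : nat) (f : nat -> R) := forall n, f (n + d)%N = f n.

Lemma periodic_modn d f n : periodic d f -> f (n %% d)%N = f n.
Proof.
move=> pf; rewrite [in RHS](divn_eq n d) addnC.
by elim: (n %/ d)%N => [|q IH]; rewrite ?addn0 // mulSn [(d + _)%N]addnC addnA pf.
Qed.

Lemma periodicM d e f g : periodic d f -> periodic e g ->
  periodic (d * e) (fun n => f n * g n).
Proof.
move=> pf pg n.
rewrite -(periodic_modn (n + _) pf) -(periodic_modn (n + _) pg).
rewrite [in f _]addnC [in f _]mulnC modnMDl [in g _]addnC modnMDl.
by rewrite (periodic_modn n pf) (periodic_modn n pg).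
Qed.

(** By the Chinese remainder theorem the two residues vary independently. *)
Lemma periodic_sumM d e f g : (0 < d)%N -> (0 < e)%N -> coprime d e ->
  periodic d f -> periodic e g ->
  \sum_(n < d * e) f n * g n = (\sum_(n < d) f n) * (\sum_(n < e) g n).
Proof.
move=> d0 e0 cde pf pg.
rewrite big_distrlr /= pair_big /=.
pose h (n : 'I_(d * e)) : 'I_d * 'I_e :=
  (Ordinal (ltn_pmod n d0), Ordinal (ltn_pmod n e0)).
have bh : bijective h.
  apply: inj_card_bij; last by rewrite card_prod !card_ord.
  move=> m n [/eqP md /eqP me]; apply/val_inj => /=.
  have := chinese_remainder cde m n.
  rewrite md me /= => /eqP; by rewrite !modn_small.
rewrite (reindex h) /=; last exact: onW_bij.
by apply: eq_bigr => n _; rewrite !periodic_modn.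
Qed.

(** Full periods contribute exactly their average. On the incomplete last one, the sum and its
    expected value both lie between 0 and the sum over a period. *)
Lemma periodic_sum_dist d f N : (0 < d)%N -> (forall n, 0 <= f n) ->
  periodic d f ->
  `|\sum_(n < N) f n - N%:R * ((\sum_(n < d) f n) / d%:R)| <= \sum_(n < d) f n.
Proof.
move=> d0 f0 pf; set c := \sum_(n < d) f n.
have c0 : 0 <= c by rewrite sumr_ge0.
have E q t : \sum_(n < q * d + t) f n = q%:R * c + \sum_(n < t) f n.
  elim: q => [|q IH]; first by rewrite mul0n add0n mul0r add0r.
  rewrite mulSn -addnA big_split_ord /= -/c -[q.+1%:R]natr1 mulrDl mul1r.
  under eq_bigr => i _ do rewrite addnC pf.
  by rewrite IH; ring.
have := E (N %/ d)%N (N %% d)%N; rewrite -divn_eq => ->.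
have td : (N %% d <= d)%N by rewrite ltnW // ltn_pmod.
have [s0 sc] : 0 <= \sum_(n < N %% d) f n /\ \sum_(n < N %% d) f n <= c.
  split; first exact: sumr_ge0.
  rewrite (big_ord_widen _ f td) /c.
  by rewrite [leRHS](bigID (fun i : 'I_d => (i < N %% d)%N)) /= lerDl sumr_ge0.
have -> : N%:R = (N %/ d)%:R * d%:R + (N %% d)%:R :> R.
  by rewrite -natrM -natrD -divn_eq.
have dn0 : 0 < d%:R :> R by rewrite ltr0n.
have -> : (N %/ d)%:R * c + \sum_(n < N %% d) f n -
    ((N %/ d)%:R * d%:R + (N %% d)%:R) * (c / d%:R) =
    \sum_(n < N %% d) f n - (N %% d)%:R / d%:R * c.
  by field; rewrite gt_eqF.
have t1 : 0 <= ((N %% d)%:R : R) / d%:R <= 1.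
  by rewrite divr_ge0 //= ler_pdivrMr // mul1r ler_nat.
rewrite ler_norml; nra.
Qed.

(* The factor [f], a product of values of [h] at smaller steps, makes the induction on [s]
   go through. *)
Lemma bonf_avg (h : nat -> nat -> R) (c : nat -> R) s r d f N :
  uniq s -> all prime s -> (0 < d)%N -> all (coprime d) s ->
  (forall n, 0 <= f n) -> periodic d f ->
  {in s, forall l, [/\ forall n, 0 <= h l n, periodic l (h l),
    \sum_(n < l) h l n = c l & c l <= 2]} ->
  `|\sum_(n < N) f n * bonf (h^~ n) s r -
    N%:R * ((\sum_(n < d) f n) / d%:R * bonf (fun l => c l / l%:R) s r)|
  <= (\sum_(n < d) f n) * (1 + 2 * (size s)%:R) ^+ r.
Proof.
elim: s r d f => [|l s IH] r d f us ps d0 cs f0 pf hs.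
  have b1 g : bonf g [::] r = 1 by case: r.
  under eq_bigr => n _ do rewrite b1 mulr1.
  by rewrite b1 !mulr1 mulr0 addr0 expr1n mulr1; apply: periodic_sum_dist.
case: r => [|r].
  under eq_bigr => n _ do rewrite mulr1.
  by rewrite /= !mulr1; apply: periodic_sum_dist.
move: us ps cs => /= /andP[ls us] /andP[pl ps] /andP[cl cs].
have [hl0 pl_ hlc cl2] := hs l (mem_head _ _).
have hs' : {in s, forall l, [/\ forall n, 0 <= h l n, periodic l (h l),
    \sum_(n < l) h l n = c l & c l <= 2]}.
  by move=> m ms; apply: hs; rewrite inE ms orbT.
have l0 := prime_gt0 pl.
have IH1 := IH r.+1 d f us ps d0 cs f0 pf hs'.
have cs' : all (coprime (d * l)) s.
  apply/allP => m ms; rewrite coprimeMl (allP cs) //= prime_coprime //.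
  rewrite dvdn_prime2 // ?(allP ps) //.
  by apply: contraNneq ls => ->.
have f'0 n : 0 <= f n * h l n by rewrite mulr_ge0.
have dl0 : (0 < d * l)%N by rewrite muln_gt0 d0.
have IH2 := IH r (d * l)%N (fun n => f n * h l n) us ps dl0 cs' f'0
  (periodicM pf pl_) hs'.
move: IH1 IH2; rewrite periodic_sumM // hlc.
set C := \sum_(n < d) f n; have C0 : 0 <= C by rewrite sumr_ge0.
have c0 : 0 <= c l by rewrite -hlc sumr_ge0.
set X := \sum_(n < N) f n * bonf _ s r.+1; set Y := \sum_(n < N) _.
set g := fun l => c l / l%:R; set m : R := (size s)%:R => IH1 IH2.
have -> : \sum_(n < N) f n * (bonf (h^~ n) s r.+1 - h l n * bonf (h^~ n) s r) = X - Y.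
  by rewrite -sumrB; apply: eq_bigr => n _; ring.
have -> : X - Y - N%:R * (C / d%:R * (bonf g s r.+1 - g l * bonf g s r)) =
   (X - N%:R * (C / d%:R * bonf g s r.+1)) -
   (Y - N%:R * (C * c l / (d * l)%:R * bonf g s r)).
  by rewrite natrM /g; field; rewrite !pnatr_eq0 -!lt0n l0.
(* The two errors add up to [C ((1 + 2 m)^(r+1) + c_l (1 + 2 m)^r)], and [c_l <= 2]. *)
apply: le_trans (ler_normB _ _) _; apply: le_trans (lerD IH1 IH2) _.
have m0 : 0 <= m by rewrite ler0n.
have -> : (size s).+1%:R = m + 1 :> R by rewrite -natr1.
have e1 : (1 + 2 * m) ^+ r <= (1 + 2 * (m + 1)) ^+ r.
  by rewrite lerXn2r ?nnegrE; lra.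
have e0 : 0 <= (1 + 2 * m) ^+ r by rewrite exprn_ge0; lra.
rewrite -mulrA -mulrDr ler_wpM2l // !exprS.
set u := _ ^+ r in e0 e1 *; set w := _ ^+ r in e1 *.
nra.
Qed.

Lemma prod_subr_le_expR a s : {in s, forall l, a l <= 1} ->
  \prod_(l <- s) (1 - a l) <= expR (- \sum_(l <- s) a l).
Proof.
elim: s => [|l s IH] ha; first by rewrite !big_nil oppr0 expR0.
rewrite !big_cons opprD expRD; apply: ler_pM.
- by rewrite subr_ge0 ha ?mem_head.
- rewrite big_seq prodr_ge0 // => m ms.
  by rewrite subr_ge0 ha // inE ms orbT.
- exact: expR_ge1Dx.
- by apply: IH => m ms; rewrite ha // inE ms orbT.
Qed.

(** An even truncation bounds the product from above at every [n]; [bonf_avg] averages it, and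
    [bonf_dist] leads back to the full product of densities. The terms are the main term, the
    truncation error and the rounding error. *)
Lemma brun_sieve (h : nat -> nat -> R) (c : nat -> R) s r N :
  uniq s -> all prime s -> ~~ odd r ->
  {in s, forall l, [/\ forall n, 0 <= h l n <= 1, periodic l (h l),
    \sum_(n < l) h l n = c l & c l <= 2]} ->
  \sum_(n < N) \prod_(l <- s) (1 - h l n) <=
    N%:R * (expR (- \sum_(l <- s) c l / l%:R) +
            (\sum_(l <- s) c l / l%:R) ^+ r.+1 / (r.+1)`!%:R) +
    (1 + 2 * (size s)%:R) ^+ r.
Proof.
move=> us ps er hs.
have cl01 : {in s, forall l, 0 <= c l / l%:R <= 1}.
  move=> l ls; have [h01 _ <- _] := hs l ls.
  have l0 := prime_gt0 (allP ps _ ls).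
  rewrite divr_ge0 ?sumr_ge0 //=; last by move=> n _; case/andP: (h01 n).
  rewrite ler_pdivrMr ?ltr0n // mul1r.
  apply: le_trans (ler_sum _ (fun (n : 'I_l) _ => proj2 (andP (h01 n)))) _.
  by rewrite sumr_const card_ord.
have step : \sum_(n < N) \prod_(l <- s) (1 - h l n) <= \sum_(n < N) bonf (h^~ n) s r.
  apply: ler_sum => n _; have := @bonf_bonferroni (h^~ n) s r.
  by rewrite (negbTE er); apply => l /hs[].
apply: le_trans step _.
have := @bonf_avg h c s r 1%N (fun _ => 1) N us ps isT.
have -> : all (coprime 1) s by apply/allP => l _; rewrite coprime1n.
have p1 : periodic 1 (fun _ => 1 : R) by [].
move=> /(_ isT (fun _ => ler01) p1) /(_ _)/wrap[].
  by move=> l /hs[h01 *]; split=> // n; case/andP: (h01 n).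
under eq_bigr => n _ do rewrite mul1r.
rewrite big_ord_recl big_ord0 addr0 !mul1r invr1 mul1r ler_norml => /andP[_].
rewrite lerBlDl => /le_trans; apply; rewrite lerD2r ler_wpM2l //.
have := bonf_dist r cl01; rewrite ler_norml => /andP[_].
rewrite lerBlDl => /le_trans; apply; rewrite lerD2r.
by apply: prod_subr_le_expR => l /cl01 /andP[].
Qed.

End Sieve.

(** * Harmonic sums over sifted integers *)

Section Sums.
Variable R : realType.

Lemma sumr_uniq_sub (T : eqType) (s t : seq T) (F : T -> R) : uniq s ->
  uniq t -> {subset s <= t} -> {in t, forall x, 0 <= F x} ->
  \sum_(x <- s) F x <= \sum_(x <- t) F x.
Proof.
move=> us ut st F0; rewrite [leRHS](bigID (mem s)) /=.
have -> : \sum_(x <- t | x \in s) F x = \sum_(x <- s) F x.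
  rewrite -big_filter; apply: perm_big; apply: uniq_perm => //.
    by rewrite filter_uniq.
  by move=> x; rewrite mem_filter andb_idr // => /st.
by rewrite lerDl big_seq_cond sumr_ge0 // => x /andP[/F0].
Qed.

Lemma sum_nat_dvd (d x : nat) (P : pred nat) (F : nat -> R) : (0 < d)%N ->
  \sum_(1 <= n < x.+1 | P n && (d %| n)%N) F n =
  \sum_(1 <= m < (x %/ d).+1 | P (d * m)%N) F (d * m)%N.
Proof.
move=> d0; rewrite -(big_map (muln d) P F) -[LHS]big_filter -[RHS]big_filter.
apply: perm_big; apply: uniq_perm.
- by rewrite filter_uniq // iota_uniq.
- rewrite filter_uniq // map_inj_uniq ?iota_uniq //.
  by move=> u v /eqP; rewrite eqn_pmul2l // => /eqP.
move=> n; rewrite !mem_filter -andbA; congr (_ && _).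
apply/andP/mapP => [[/dvdnP[m ->]]|[m]].
  rewrite mem_index_iota => h; exists m; last by rewrite mulnC.
  by rewrite mem_index_iota ltnS leq_divRL //; case: m h => //; lia.
rewrite mem_index_iota ltnS leq_divRL // => h ->.
by rewrite dvdn_mulr // mem_index_iota; split => //; nia.
Qed.

Definition harm (x : nat) : R := \sum_(1 <= n < x.+1) n%:R^-1.

Lemma harmS x : harm x.+1 = harm x + x.+1%:R^-1.
Proof. by rewrite /harm big_nat_recr. Qed.

Lemma harm_ge_ln x : ln (x.+1%:R : R) <= harm x.
Proof.
elim: x => [|x IH]; first by rewrite ln1 /harm big_geq.
rewrite harmS; apply: le_trans (lerD IH (lexx _)).
have x0 : 0 < x.+1%:R :> R by rewrite ltr0n.
have -> : x.+2%:R = x.+1%:R * (1 + x.+1%:R^-1) :> R.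
  by rewrite -[x.+2%:R]natr1; field; rewrite gt_eqF.
have i0 : 0 < x.+1%:R^-1 :> R by rewrite invr_gt0.
rewrite lnM ?posrE //.
by rewrite lerD2l le_ln1Dx // (lt_trans _ i0) // ltrN10.
Qed.

Lemma harm_le_ln x : (0 < x)%N -> harm x <= 1 + ln (x%:R : R).
Proof.
case: x => // x _; elim: x => [|x IH].
  by rewrite ln1 addr0 harmS /harm big_geq // add0r invr1.
rewrite harmS; apply: le_trans (lerD IH (lexx _)) _.
have x0 : 0 < x.+2%:R :> R by rewrite ltr0n.
have x1 : 0 < x.+1%:R :> R by rewrite ltr0n.
have i1 : x.+2%:R^-1 < 1 :> R by rewrite invf_lt1 // ltr1n.
have e : x.+1%:R = x.+2%:R * (1 + - x.+2%:R^-1) :> R.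
  by rewrite mulrDr mulr1 mulrN divff ?gt_eqF // -[x.+2%:R]natr1 addrK.
have : ln (x.+1%:R : R) <= ln x.+2%:R - x.+2%:R^-1.
  rewrite e lnM ?posrE ?subr_gt0 //.
  by rewrite lerD2l le_ln1Dx // ltrN2.
set i := x.+2%:R^-1; lra.
Qed.

(** Telescoping of [1/(l - 1) - 1/l]. *)
Lemma sum_inv_oblong (s : seq nat) : uniq s -> all (leq 2) s ->
  \sum_(l <- s) (l%:R * l.-1%:R)^-1 <= 1 :> R.
Proof.
move=> us s2; pose M := (\max_(l <- s) l).+1.
apply: le_trans (_ : \sum_(l <- index_iota 2 M.+1) (l%:R * l.-1%:R)^-1 <= _).
  apply: sumr_uniq_sub => //; first exact: iota_uniq.
  move=> l ls; rewrite mem_index_iota (allP s2) //=.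
  by rewrite /M ltnS ltnW // ltnS; exact: (@leq_bigmax_seq _ s xpredT id).
have -> : \sum_(l <- index_iota 2 M.+1) (l%:R * l.-1%:R)^-1 = 1 - M%:R^-1 :> R.
  rewrite /M; elim: (\max_(l <- s) l) => [|m IH].
    by rewrite big_geq // invr1 subrr.
  rewrite big_nat_recr //= IH -[m.+2%:R]natr1 -natr1.
  have m0 : 0 <= m%:R :> R by rewrite ler0n.
  by field; apply/andP; split; apply: lt0r_neq0; lra.
by rewrite lerBlDl lerDr invr_ge0.
Qed.

Definition sifted (s : seq nat) (n : nat) := all (fun l => ~~ (l %| n)%N) s.

(* Removing the multiples of a new prime [l] from a sifted set removes at most [1 / l]
   of its harmonic sum, since [l m] sifted implies [m] sifted. *)
Lemma prod_harm_le_sifted (s : seq nat) x : all prime s ->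
  \prod_(l <- s) (1 - l%:R^-1) * harm x
    <= \sum_(1 <= n < x.+1 | sifted s n) n%:R^-1 :> R.
Proof.
elim: s => [|l s IH] /=; first by rewrite big_nil mul1r.
move=> /andP[pl ps]; rewrite big_cons -mulrA.
have l0 := prime_gt0 pl.
set G := \sum_(1 <= n < x.+1 | sifted s n) n%:R^-1 in IH *.
have -> : \sum_(1 <= n < x.+1 | sifted (l :: s) n) n%:R^-1 =
    G - \sum_(1 <= n < x.+1 | sifted s n && (l %| n)%N) n%:R^-1 :> R.
  rewrite /G [in RHS](bigID (fun n => l %| n)%N) /= addrAC subrr add0r.
  by apply: eq_bigl => n; rewrite andbC.
have l1 : 1 <= l%:R :> R by rewrite ler1n.
have li : 0 <= (l%:R^-1 : R) <= 1 by rewrite invr_ge0 ler0n invf_le1 //; lra.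
suff : \sum_(1 <= n < x.+1 | sifted s n && (l %| n)%N) n%:R^-1 <= l%:R^-1 * G.
  by have := IH ps; nra.
rewrite sum_nat_dvd // /G mulr_sumr.
rewrite -[leLHS]big_filter -[leRHS]big_filter.
under eq_bigr => m _ do rewrite natrM invfM.
apply: sumr_uniq_sub; rewrite ?filter_uniq ?iota_uniq //.
move=> m; rewrite !mem_filter !mem_index_iota => /andP[sm /andP[-> mx]] /=.
  apply/andP; split; last by apply: leq_trans mx _; rewrite ltnS leq_div.
  apply: sub_all sm => k; apply: contraNN => km; exact: dvdn_mull.
Qed.

(** [1/(1 - 1/l) = 1 + 1/l + 1/(l (l - 1)) <= exp (1/l + 1/(l (l - 1)))], and the quadratic terms
    sum to at most 1. *)
Lemma harm_le_expR_sifted (s : seq nat) x : uniq s -> all prime s ->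
  harm x <= expR (1 + \sum_(l <- s) l%:R^-1) *
    \sum_(1 <= n < x.+1 | sifted s n) n%:R^-1 :> R.
Proof.
move=> us ps; have := prod_harm_le_sifted x ps; set G := \sum_(1 <= n < _ | _) _.
set P := \prod_(l <- s) _ => h.
have s2 : all (leq 2) s by apply: sub_all ps => l; exact: prime_gt1.
have P0 : 0 < P.
  rewrite /P big_seq prodr_gt0 // => l ls.
  by rewrite subr_gt0 invf_lt1 ?ltr1n ?ltr0n ?prime_gt0 ?prime_gt1 ?(allP ps).
have Pe : P^-1 <= expR (1 + \sum_(l <- s) l%:R^-1).
  rewrite /P -prodfV.
  apply: le_trans (_ : \prod_(l <- s) expR (l%:R^-1 + (l%:R * l.-1%:R)^-1) <= _).
    rewrite big_seq [leRHS]big_seq ler_prod // => l ls.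
    have l2 := allP s2 _ ls.
    have l0 : 0 < l%:R :> R by rewrite ltr0n; lia.
    have l1 : 0 < l.-1%:R :> R by rewrite ltr0n; lia.
    have e : l%:R = l.-1%:R + 1 :> R by rewrite natr1 prednK //; lia.
    have -> : (1 - l%:R^-1)^-1 = 1 + (l%:R^-1 + (l%:R * l.-1%:R)^-1) :> R.
      rewrite e; field; apply/andP; split; apply: lt0r_neq0; lra.
    by rewrite expR_ge1Dx addr_ge0 ?ler01 // addr_ge0 // invr_ge0 ?mulr_ge0 ?ltW.
  rewrite -expR_sum ler_expR big_split /= addrC lerD2r.
  exact: sum_inv_oblong.
rewrite -(ler_pM2l P0) mulrA; apply: le_trans h _.
have G0 : 0 <= G by rewrite sumr_ge0.
rewrite ler_peMl // -[leLHS](divff (lt0r_neq0 P0)) ler_wpM2l //; exact: ltW.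
Qed.

(** The lower half of Mertens' estimate: sifting by all primes up to [x] leaves only [n = 1], of
    harmonic sum 1. *)
Lemma ln_le_expR_sum_primes x :
  ln (x.+1%:R : R) <= expR (1 + \sum_(0 <= l < x.+1 | prime l) l%:R^-1).
Proof.
apply: le_trans (harm_ge_ln x) _.
have us : uniq [seq l <- index_iota 0 x.+1 | prime l].
  by rewrite filter_uniq // iota_uniq.
have ps : all prime [seq l <- index_iota 0 x.+1 | prime l] by exact: filter_all.
have := harm_le_expR_sifted x us ps.
rewrite big_filter => /le_trans; apply.
rewrite -[leRHS]mulr1 ler_wpM2l ?expR_ge0 // -[leRHS]invr1.
apply: le_trans (_ : \sum_(n <- [:: 1%N]) n%:R^-1 <= _); last by rewrite big_seq1.
rewrite -big_filter; apply: sumr_uniq_sub; rewrite ?filter_uniq ?iota_uniq //.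
move=> n; rewrite mem_filter mem_index_iota inE => /andP[sn /andP[n1 nx]].
  have [//|n2] := eqVneq n 1%N.
  have /allP/(_ (pdiv n)) := sn; rewrite pdiv_dvd mem_filter mem_index_iota.
  rewrite pdiv_prime /=; last lia.
  by apply; apply: leq_ltn_trans (pdiv_leq _) nx.
Qed.

End Sums.

(** * Primes congruent to 2 modulo 3 *)

Section Chi3.
Variable R : realType.

Definition chi3 (n : nat) : R :=
  if (n %% 3 == 1)%N then 1 else if (n %% 3 == 2)%N then -1 else 0.

Lemma chi3M m n : chi3 (m * n) = chi3 m * chi3 n.
Proof.
rewrite /chi3 -modnMm.
have := ltn_pmod n (isT : 0 < 3)%N; have := ltn_pmod m (isT : 0 < 3)%N.
case: (m %% 3)%N => [|[|[|//]]] _; case: (n %% 3)%N => [|[|[|//]]] _ /=; ring.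
Qed.

Lemma chi3_sum_le1 x : \sum_(1 <= d < x.+1) chi3 d / d%:R <= 1.
Proof.
have chiE k j : (j < 3)%N -> chi3 (3 * k + j) = chi3 j.
  by move=> j3; rewrite /chi3 mulnC modnMDl.
(* Keeping [1/(3k+1)] in reserve makes the bound inductive, since [1/(3k+2) >= 1/(3k+4)], and leaves
   room for one more positive term. *)
have step k : \sum_(1 <= d < (3 * k).+1) chi3 d / d%:R <= 1 - (3 * k + 1)%:R^-1.
  elim: k => [|k IH]; first by rewrite big_geq // invr1 subrr.
  rewrite (_ : (3 * k.+1).+1 = (3 * k).+4)%N; last lia.
  do 3 rewrite big_nat_recr //=.
  move: IH; move: (\sum_(1 <= d < (3 * k).+1) _) => u IH.
  rewrite -[(3 * k).+3]addn3 -[(3 * k).+2]addn2 -[(3 * k).+1]addn1.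
  rewrite (_ : 3 * k + 3 = 3 * k.+1 + 0)%N; last lia.
  rewrite !chiE // /chi3 /= mul0r addr0 mul1r mulN1r.
  have : ((3 * k.+1 + 1)%:R : R)^-1 <= (3 * k + 2)%:R^-1.
    by rewrite lef_pV2 ?posrE ?ltr0n ?ler_nat; lia.
  move: IH; move: ((3 * k + 1)%:R^-1) ((3 * k + 2)%:R^-1) ((3 * k.+1 + 1)%:R^-1).
  by move=> a b c; lra.
have ip (n : nat) : 0 <= n%:R^-1 :> R by rewrite invr_ge0.
have := step (x %/ 3)%N; have := divn_eq x 3; have := ltn_pmod x (isT : 0 < 3)%N.
rewrite [(_ * 3)%N]mulnC; move: (x %/ 3)%N (x %% 3)%N => k j j3 -> sk.
case: j j3 => [|[|[|//]]] _; rewrite ?addn0 ?addn1 ?addn2.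
- by have := ip (3 * k + 1)%N; lra.
- rewrite big_nat_recr //=; move: sk; move: (\sum_(1 <= d < (3 * k).+1) _) => u.
  by rewrite -[(3 * k).+1]addn1 chiE // /chi3 /= mul1r; lra.
- do 2 rewrite big_nat_recr //=.
  move: sk; move: (\sum_(1 <= d < (3 * k).+1) _) => u sk.
  rewrite -[(3 * k).+2]addn2 -[(3 * k).+1]addn1.
  rewrite !chiE // /chi3 /= mul1r mulN1r.
  by have := ip (3 * k + 2)%N; move: sk; lra.
Qed.

(** For [n > 0], a sixth of the number of representations of [n] by the form [x^2 + x y + y^2]. *)
Definition rr3 (n : nat) : R := \sum_(d <- divisors n) chi3 d.

Definition rr3_prime_to (l n : nat) : R :=
  \sum_(d <- divisors n | ~~ (l %| d)%N) chi3 d.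

Lemma rr3_prime_toM l n : prime l -> (0 < n)%N ->
  rr3_prime_to l (l * n) = rr3_prime_to l n.
Proof.
move=> pl n0; have l0 := prime_gt0 pl.
rewrite /rr3_prime_to -[LHS]big_filter -[RHS]big_filter.
apply: perm_big; apply: uniq_perm; rewrite ?filter_uniq ?divisors_uniq //.
move=> d; rewrite !mem_filter -!dvdn_divisors ?muln_gt0 ?l0 //.
case: (boolP (l %| d)%N) => //= ld.
by rewrite Gauss_dvdr // coprime_sym prime_coprime.
Qed.

(** A divisor of [l n] is either prime to [l], hence a divisor of [n], or [l] times a divisor of
    [n]. *)
Lemma rr3_primeM l n : prime l -> (0 < n)%N ->
  rr3 (l * n) = rr3_prime_to l n + chi3 l * rr3 n.
Proof.
move=> pl n0; have l0 := prime_gt0 pl.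
rewrite /rr3 (bigID (fun d => ~~ (l %| d)%N)) /=.
rewrite -/(rr3_prime_to l (l * n)) rr3_prime_toM //; congr (_ + _).
rewrite mulr_sumr; under [RHS]eq_bigr => d _ do rewrite -chi3M.
rewrite -(big_map (muln l) xpredT chi3) -[LHS]big_filter.
apply: perm_big; apply: uniq_perm; rewrite ?filter_uniq ?divisors_uniq //.
  rewrite map_inj_uniq ?divisors_uniq //.
  by move=> u v /eqP; rewrite eqn_pmul2l // => /eqP.
move=> d; rewrite mem_filter negbK -dvdn_divisors ?muln_gt0 ?l0 //.
apply/andP/mapP => [[/dvdnP[k ->]]|[k]].
  rewrite mulnC dvdn_pmul2l // => kn.
  by exists k => //; rewrite -dvdn_divisors.
by rewrite -dvdn_divisors // => kn ->; rewrite dvdn_mulr // dvdn_pmul2l.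
Qed.

Lemma rr3_prime_to_coprime l n : (0 < n)%N -> ~~ (l %| n)%N ->
  rr3_prime_to l n = rr3 n.
Proof.
move=> n0 ln; rewrite /rr3_prime_to /rr3 big_seq_cond [RHS]big_seq.
apply: eq_bigl => d; rewrite -dvdn_divisors //; case: (boolP (d %| n)%N) => //= dn.
by apply: contraNN ln => /dvdn_trans; apply.
Qed.

(** Strong induction, removing the smallest prime factor [l]. If [chi3 l = -1], then
    [rr3 (l l m') = rr3 m'], and [rr3 (l m) = 0] when [l] does not divide [m]. *)
Lemma rr3_ge0 n : (0 < n)%N -> 0 <= rr3 n.
Proof.
have [k] := ubnP n; elim: k n => // k IH n nk n0.
have [->|n1] := eqVneq n 1%N; first by rewrite /rr3 /= big_seq1.
have pl : prime (pdiv n) by rewrite pdiv_prime; lia.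
have /dvdnP[m nE] := pdiv_dvd n; move: pl nE; set l := pdiv n => pl nE.
have l1 := prime_gt1 pl.
have m0 : (0 < m)%N by case: m nE n0 => // ->.
have mn : (m < k)%N by nia.
have prime_to_ge0 j : (0 < j)%N -> (j < k)%N -> 0 <= rr3_prime_to l j.
  have [i] := ubnP j; elim: i j => // i IHi j ji j0 jk.
  case: (boolP (l %| j)%N) => [/dvdnP[j' jE]|lj]; last first.
    by rewrite rr3_prime_to_coprime // IH.
  have j'0 : (0 < j')%N by case: j' jE j0 => // ->.
  by rewrite jE mulnC rr3_prime_toM //; apply: IHi; nia.
rewrite nE mulnC rr3_primeM //.
have rm := IH m mn m0; have tm := prime_to_ge0 m m0 mn.
rewrite {1}/chi3; case: ifP => _; first by lra.
case: ifP => // chil; last by lra.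
case: (boolP (l %| m)%N) => [/dvdnP[m' mE]|lm]; last first.
  by rewrite rr3_prime_to_coprime //; lra.
have m'0 : (0 < m')%N by case: m' mE m0 => // ->.
rewrite mE mulnC rr3_prime_toM // rr3_primeM // /chi3 (eqP chil) /=.
have : 0 <= rr3 m' by apply: IH => //; nia.
lra.
Qed.

Lemma sum_nat_mul_le (d x : nat) (F : nat -> R) : (0 < d)%N ->
  \sum_(1 <= m < x.+1 | (d * m <= x)%N) F m = \sum_(1 <= m < (x %/ d).+1) F m.
Proof.
move=> d0; rewrite -big_filter; apply: perm_big; apply: uniq_perm.
- by rewrite filter_uniq // iota_uniq.
- exact: iota_uniq.
move=> m; rewrite mem_filter !mem_index_iota !ltnS leq_divRL // mulnC.
by case: (boolP (m * d <= x)%N) => //= h; [case: m h => // m h; nia|rewrite andbF].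
Qed.

(** With [n = d m], the inner sum of [chi3 d / d] over [d <= x/m] is at most 1. *)
Lemma sum_rr3_le x : \sum_(1 <= n < x.+1) rr3 n / n%:R <= harm R x.
Proof.
have -> : \sum_(1 <= n < x.+1) rr3 n / n%:R =
    \sum_(1 <= n < x.+1) \sum_(1 <= d < x.+1 | (d %| n)%N) chi3 d / n%:R.
  apply: eq_big_nat => n /andP[n0 nx]; rewrite /rr3 mulr_suml.
  rewrite -[RHS]big_filter; apply: perm_big; apply: uniq_perm.
  - exact: divisors_uniq.
  - by rewrite filter_uniq // iota_uniq.
  move=> d; rewrite mem_filter mem_index_iota -dvdn_divisors //.
  apply/idP/andP => [dn|[]//]; split=> //; rewrite (dvdn_gt0 n0 dn).
  exact: leq_ltn_trans (dvdn_leq n0 dn) nx.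
have -> : \sum_(1 <= n < x.+1) \sum_(1 <= d < x.+1 | (d %| n)%N) chi3 d / n%:R =
    \sum_(1 <= d < x.+1) \sum_(1 <= m < x.+1 | (d * m <= x)%N)
      m%:R^-1 * (chi3 d / d%:R).
  rewrite (exchange_big_dep xpredT) //=; apply: eq_big_nat => d /andP[d0 _].
  have := @sum_nat_dvd R d x xpredT (fun n => chi3 d / n%:R) d0 => /= ->.
  rewrite sum_nat_mul_le //; apply: eq_bigr => m _.
  by rewrite natrM invfM; ring.
rewrite (exchange_big_dep xpredT) //= /harm.
apply: ler_sum_nat => m /andP[m0 _].
rewrite -mulr_sumr -[leRHS]mulr1 ler_wpM2l //.
under eq_bigl => d do rewrite mulnC.
by rewrite sum_nat_mul_le // chi3_sum_le1.
Qed.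

Definition split3 (n : nat) := all (fun l => l %% 3 == 1)%N (primes n).

Lemma split3P n : (0 < n)%N ->
  reflect (forall l, prime l -> (l %| n)%N -> (l %% 3 = 1)%N) (split3 n).
Proof.
move=> n0; apply: (iffP allP) => h l.
  by move=> pl ln; apply/eqP/h; rewrite mem_primes pl n0.
by rewrite mem_primes => /and3P[pl _ ln]; apply/eqP/h.
Qed.

Lemma split3_dvd d n : (0 < n)%N -> (d %| n)%N -> split3 n -> split3 d.
Proof.
move=> n0 dn /(split3P n0) h; apply/split3P; first exact: dvdn_gt0 dn.
by move=> l pl ld; apply: h => //; apply: dvdn_trans dn.
Qed.

Lemma split3M m n : (0 < m)%N -> (0 < n)%N -> split3 m -> split3 n ->
  split3 (m * n).
Proof.
move=> m0 n0 /(split3P m0) hm /(split3P n0) hn.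
apply/split3P; first by rewrite muln_gt0 m0.
by move=> l pl; rewrite Euclid_dvdM // => /orP[]; [apply: hm|apply: hn].
Qed.

Lemma chi3_split3 n : (0 < n)%N -> split3 n -> chi3 n = 1.
Proof.
have [k] := ubnP n; elim: k n => // k IH n nk n0 sn.
have [->//|n1] := eqVneq n 1%N.
have pl : prime (pdiv n) by rewrite pdiv_prime; lia.
have l1 := prime_gt1 pl.
have /(split3P n0)/(_ _ pl (pdiv_dvd n)) l3 := sn.
have /dvdnP[m nE] := pdiv_dvd n.
have m0 : (0 < m)%N by case: m nE n0 => // ->.
rewrite nE chi3M {2}/chi3 l3 /= mulr1; apply: IH => //; first by nia.
by apply: split3_dvd sn => //; rewrite {1}nE dvdn_mulr.
Qed.

(* [rr3 n] is nonnegative, and is the number of divisors of [n] if all the prime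
   factors of [n] are [1 mod 3]. *)
Lemma sum_split3_sqr x :
  (\sum_(1 <= n < x.+1 | split3 n) n%:R^-1) ^+ 2 <= harm R (x ^ 2).
Proof.
apply: le_trans (sum_rr3_le _).
(* For split [a, b <= x], the product [n = a b <= x^2] is split and divisible by [a]. *)
apply: le_trans (_ : \sum_(1 <= a < x.+1 | split3 a)
   \sum_(1 <= n < (x ^ 2).+1 | split3 n && (a %| n)%N) n%:R^-1 <= _).
  rewrite expr2 mulr_suml.
  rewrite big_nat_cond [leRHS]big_nat_cond; apply: ler_sum => a /andP[/andP[a0 ax] sa].
  rewrite sum_nat_dvd // mulr_sumr -[leLHS]big_filter -[leRHS]big_filter.
  under [leRHS]eq_bigr => m _ do rewrite natrM invfM.
  apply: sumr_uniq_sub; rewrite ?filter_uniq ?iota_uniq //.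
  move=> b; rewrite !mem_filter !mem_index_iota => /and3P[sb b0 bx].
  rewrite split3M // b0 /= ltnS leq_divRL //; nia.
rewrite (exchange_big_dep split3) //=; last by move=> a n _ /andP[].
rewrite [leLHS]big_mkcond /= big_nat_cond [leRHS]big_nat_cond.
apply: ler_sum => n /andP[/andP[n0 _] _].
case: ifP => sn; last by rewrite mulr_ge0 ?rr3_ge0.
rewrite /rr3 mulr_suml -[leLHS]big_filter.
have -> : \sum_(d <- divisors n) chi3 d / n%:R = \sum_(d <- divisors n) n%:R^-1.
  apply: eq_big_seq => d; rewrite -dvdn_divisors // => dn.
  rewrite chi3_split3 ?mul1r //; first exact: dvdn_gt0 dn.
  exact: split3_dvd dn sn.
apply: sumr_uniq_sub; rewrite ?filter_uniq ?iota_uniq ?divisors_uniq //.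
move=> d; rewrite mem_filter -dvdn_divisors // => /andP[/andP[_ /andP[_]]] //.
Qed.

(** Sifting by the primes that are not [1 mod 3] leaves the [split3] integers, of harmonic sum at
    most of order [sqrt (ln x)] by [sum_split3_sqr]. So these primes have reciprocal sum at least
    [(1/2) ln ln x - O(1)]. *)
Lemma ln_le_expR_sum_primes_mod3 x : (1 < x)%N ->
  ln (x%:R : R) ^+ 2 <=
  expR (2 + 2 * \sum_(0 <= l < x.+1 | prime l && (l %% 3 != 1)%N) l%:R^-1) *
  (1 + 2 * ln x%:R).
Proof.
move=> x1; set s := [seq l <- index_iota 0 x.+1 | prime l && (l %% 3 != 1)%N].
have us : uniq s by rewrite filter_uniq // iota_uniq.
have ps : all prime s by apply/allP => l; rewrite mem_filter => /andP[/andP[]].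
have := harm_le_expR_sifted R x us ps.
rewrite big_filter; set S := \sum_(0 <= l < _ | _) _.
have -> : \sum_(1 <= n < x.+1 | sifted s n) n%:R^-1 =
    \sum_(1 <= n < x.+1 | split3 n) n%:R^-1 :> R.
  rewrite big_nat_cond [RHS]big_nat_cond; apply: eq_bigl => n.
  case: (boolP (0 < n < x.+1)%N) => //= /andP[n0 nx].
  apply/allP/split3P => // h l.
    move=> pl ln; apply: contraTeq (ln) => l3; apply: h.
    rewrite mem_filter pl l3 mem_index_iota.
    exact: leq_ltn_trans (dvdn_leq n0 ln) nx.
  rewrite mem_filter => /andP[/andP[pl l3] _].
  by apply: contraNN l3 => ln; rewrite h.
set G := \sum_(1 <= n < _ | _) _ => hG.
have G0 : 0 <= G by rewrite sumr_ge0.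
have x0 : 0 < x%:R :> R by rewrite ltr0n; lia.
have hx : ln (x%:R : R) <= expR (1 + S) * G.
  apply: le_trans hG; apply: le_trans (harm_ge_ln R x).
  by rewrite ler_ln ?posrE ?ltr0n ?ler_nat //; lia.
have lx0 : 0 <= ln (x%:R : R) by rewrite ln_ge0 // ler1n; lia.
apply: le_trans (_ : (expR (1 + S) * G) ^+ 2 <= _).
  by rewrite lerXn2r ?nnegrE // mulr_ge0 ?expR_ge0.
rewrite exprMn -expRM_natl (_ : 2%:R * (1 + S) = 2 + 2 * S); last by ring.
rewrite ler_wpM2l ?expR_ge0 //; apply: le_trans (sum_split3_sqr x) _.
apply: le_trans (harm_le_ln R _) _; first by rewrite expn_gt0; lia.
by rewrite natrX lnXn // mulr2n; lra.
Qed.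

End Chi3.

(** * Chebyshev's estimates *)

Lemma prime_dvd_fact p n : prime p -> (p %| n`!)%N -> (p <= n)%N.
Proof.
move=> pp; elim: n => [|n IH]; first by rewrite dvdn1 => /eqP p1; rewrite p1 in pp.
by rewrite factS Euclid_dvdM // => /orP[/dvdn_leq->//|/IH/leqW].
Qed.

Lemma leq_central_bin n : (2 ^ n <= 'C(2 * n, n) <= 4 ^ n)%N.
Proof.
have sumC k : (2 ^ k = \sum_(i < k.+1) 'C(k, i))%N.
  rewrite -[2%N]/(1 + 1)%N expnDn; apply: eq_bigr => i _.
  by rewrite !exp1n !muln1.
apply/andP; split.
  rewrite mul2n -addnn -binomial.Vandermonde sumC; apply: leq_sum => i _.
  by rewrite leq_pmulr // bin_gt0 leq_subr.
rewrite (_ : 4 = 2 ^ 2)%N // -expnM sumC.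
have h : (n < (2 * n).+1)%N by lia.
by rewrite (bigD1 (Ordinal h)) //= leq_addr.
Qed.

Lemma leq_expn_prod (s : seq nat) k : all (leq k) s ->
  (k ^ size s <= \prod_(p <- s) p)%N.
Proof.
elim: s => [|p s IH]; first by rewrite big_nil.
by move=> /= /andP[kp ks]; rewrite big_cons expnS leq_mul // IH.
Qed.

(** Primes in [(n, 2n]] divide [(2n)!] but not [n!], so their product divides [C(2n, n) <= 4^n]. *)
Lemma chebyshev_upper n :
  (n ^ size [seq p <- index_iota n.+1 (2 * n).+1 | prime p] <= 4 ^ n)%N.
Proof.
set s := [seq p <- _ | _]; have /andP[_ /(leq_trans _)] := leq_central_bin n; apply.
have C0 : (0 < 'C(2 * n, n))%N by rewrite bin_gt0; lia.
apply: leq_trans (@leq_expn_prod s n _) _.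
  by apply/allP => p; rewrite mem_filter mem_index_iota => /andP[_ /andP[/ltnW]].
apply: dvdn_leq C0 _; apply: prime_seq_prod_dvd.
- by rewrite filter_uniq // iota_uniq.
- exact: filter_all.
move=> p; rewrite mem_filter mem_index_iota ltnS => /and3P[pp np p2n].
have : (p %| (2 * n)`!)%N by rewrite dvdn_fact // p2n prime_gt0.
rewrite -(@bin_fact (2 * n) n); last lia.
rewrite Euclid_dvdM // => /orP[//|]; rewrite (_ : 2 * n - n = n)%N; last lia.
by rewrite Euclid_dvdM // orbb => /(prime_dvd_fact pp); rewrite leqNgt np.
Qed.

(** Legendre's formula: the exponent is the sum over [k] of [2n %/ p^k - 2 (n %/ p^k)], whose terms
    are 0 or 1 and vanish when [p^k > 2n]. *)
Lemma logn_central_bin p n : prime p -> (0 < n)%N ->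
  (p ^ logn p 'C(2 * n, n) <= 2 * n)%N.
Proof.
move=> pp n0; have p1 := prime_gt1 pp; have p0 := prime_gt0 pp.
have C0 : (0 < 'C(2 * n, n))%N by rewrite bin_gt0; lia.
apply: leq_trans (trunc_logP p1 (_ : 0 < 2 * n)%N); last lia.
rewrite leq_exp2l //.
have : (logn p 'C(2 * n, n) + 2 * logn p n`! = logn p (2 * n)`!)%N.
  rewrite -(@bin_fact (2 * n) n); last lia.
  rewrite (_ : 2 * n - n = n)%N; last lia.
  by rewrite !lognM ?muln_gt0 ?fact_gt0 //; lia.
rewrite !logn_fact //.
have -> : (\sum_(1 <= k < n.+1) n %/ p ^ k =
    \sum_(1 <= k < (2 * n).+1) n %/ p ^ k)%N.
  rewrite [RHS](big_cat_nat (n := n.+1)) //=; last lia.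
  rewrite [X in (_ + X)%N]big_nat_cond [X in (_ + X)%N]big1 ?addn0 //.
  move=> k /andP[/andP[nk _] _].
  by rewrite divn_small // (ltn_trans nk) // ltn_expl.
rewrite big_distrr /= => e.
have : (\sum_(1 <= k < (2 * n).+1) (2 * n) %/ p ^ k <=
    trunc_log p (2 * n) + \sum_(1 <= k < (2 * n).+1) 2 * (n %/ p ^ k))%N.
  apply: leq_trans (_ : \sum_(1 <= k < (2 * n).+1)
     ((k <= trunc_log p (2 * n)) + 2 * (n %/ p ^ k)) <= _)%N.
    apply: leq_sum => k _; have q0 : (0 < p ^ k)%N by rewrite expn_gt0 p0.
    case: (leqP k) => [_|h] /=.
      rewrite -ltnS ltn_divLR // {1}(divn_eq n (p ^ k)).
      by have := ltn_pmod n q0; nia.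
    rewrite divn_small // ltnNge; apply/negP => /(trunc_log_max p1).
    by rewrite leqNgt h.
  rewrite big_split /= leq_add2r; set t := trunc_log _ _.
  rewrite -big_mkcond sum1_count.
  apply: leq_trans (_ : size (iota 1 t) <= _)%N; last by rewrite size_iota.
  rewrite -size_filter; apply: uniq_leq_size; rewrite ?filter_uniq ?iota_uniq //.
  move=> k; rewrite mem_filter mem_index_iota mem_iota => /and3P[kt k1 _].
  by rewrite k1 add1n ltnS.
by lia.
Qed.

(** [2^n <= C(2n, n)], a product of prime powers that are at most [2n] by [logn_central_bin]. *)
Lemma chebyshev_lower n : (0 < n)%N ->
  (2 ^ n <= (2 * n) ^ size [seq p <- index_iota 1 (2 * n).+1 | prime p])%N.
Proof.
move=> n0; have /andP[/leq_trans + _] := leq_central_bin n; apply.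
have C0 : (0 < 'C(2 * n, n))%N by rewrite bin_gt0; lia.
rewrite {1}(prod_prime_decomp C0) prime_decompE big_map /=.
apply: leq_trans (_ : (2 * n) ^ size (primes 'C(2 * n, n)) <= _)%N.
  elim: (primes _) (all_prime_primes 'C(2 * n, n)) => [|p s IH] /=.
    by rewrite big_nil.
  by move=> /andP[pp ps]; rewrite big_cons expnS leq_mul ?IH ?logn_central_bin.
rewrite leq_pexp2l //; first lia.
apply: uniq_leq_size; first exact: primes_uniq.
move=> p; rewrite mem_primes mem_filter mem_index_iota => /and3P[pp _ pC].
rewrite pp prime_gt0 //= ltnS; apply: prime_dvd_fact pp _.
by rewrite -(@bin_fact (2 * n) n) ?dvdn_mulr //; lia.
Qed.

Section Chebyshev.
Variable R : realType.

Lemma ln2_ge : 2^-1 <= ln (2 : R).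
Proof.
have : ln (2^-1 : R) <= - 2^-1.
  rewrite {1}(_ : 2^-1 = 1 + - 2^-1); last by field.
  by rewrite le_ln1Dx //; lra.
by rewrite lnV ?posrE //; lra.
Qed.

(** By [chebyshev_upper], [(2^j, 2^(j+1)]] has at most [2 * 2^j / j] primes, of reciprocal sum at
    most [2/j]. Being twice too large is harmless: this only controls the error terms of the
    sieve. *)
Lemma sum_primes_dyadic_le m :
  \sum_(0 <= l < (2 ^ m.+1).+1 | prime l) l%:R^-1 <= 2^-1 + 2 * harm R m.
Proof.
elim: m => [|m IH].
  by rewrite big_mkcond /index_iota /= !big_cons big_nil /= /harm big_geq //; lra.
rewrite harmS mulrDr addrA.
have h : (2 ^ m.+1 < (2 ^ m.+2).+1)%N by rewrite ltnS leq_exp2l.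
rewrite (big_cat_nat (n := (2 ^ m.+1).+1)) //=; apply: lerD IH _.
have := chebyshev_upper (2 ^ m.+1); rewrite -expnS.
rewrite -big_filter; set s := [seq p <- _ | _] => hs.
have n0 : 0 < (2 ^ m.+1)%:R :> R by rewrite ltr0n expn_gt0.
apply: le_trans (_ : \sum_(l <- s) (2 ^ m.+1)%:R^-1 <= _).
  rewrite big_seq [leRHS]big_seq; apply: ler_sum => l.
  rewrite mem_filter mem_index_iota => /and3P[_ ml _].
  by rewrite lef_pV2 ?posrE ?ltr0n ?ler_nat; lia.
rewrite big_const_seq count_predT iter_addr_0 -[_ *+ size s]mulr_natr.
rewrite mulrC ler_pdivrMr // mulrAC ler_pdivlMr ?ltr0n // -!natrM ler_nat.
move: hs; rewrite -[4%N]/(2 ^ 2)%N -!expnM leq_exp2l //; lia.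
Qed.

End Chebyshev.

(** * Choice of the sieve parameters *)

Section SieveLevel.
Variable R : realType.

(* [N >= 2 ^ (4 v ^ 40)] is sieved to order [2 v] by the primes up to
   [2 ^ (v ^ 39)]: then [ln v] stands for [ln (ln N) / 40], and sieving only up to
   [exp ((ln N) ^ (39 / 40))] costs a power of [ln N] small enough to be absorbed by the
   savings, while the remainder terms of the pure sieve are smaller than any power. *)
Definition sieve_level (v : nat) := (2 ^ (v ^ 39))%N.

(** Starting above 3 makes [l %| n] and [l %| n + b] exclusive for [0 < b < 4], and provides the
    condition [3 < l] of the [es_count] lemmas. *)
Definition sieve_primes (v : nat) :=
  [seq l <- index_iota 4 (sieve_level v).+1 | prime l].

Lemma sieve_primesP v l : l \in sieve_primes v ->
  [/\ prime l, (3 < l)%N & (l <= sieve_level v)%N].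
Proof. by rewrite mem_filter mem_index_iota ltnS => /and3P[]. Qed.

Lemma sieve_primes_uniq v : uniq (sieve_primes v).
Proof. by rewrite filter_uniq // iota_uniq. Qed.

Lemma sieve_primes_prime v : all prime (sieve_primes v).
Proof. exact: filter_all. Qed.

Lemma sieve_exp_ge2 v : (1 < v)%N -> (2 <= v ^ 39)%N.
Proof.
move=> v1; apply: (leq_trans v1); rewrite -{1}(expn1 v).
by rewrite leq_pexp2l //; lia.
Qed.

Lemma sieve_level_ge4 v : (1 < v)%N -> (4 <= sieve_level v)%N.
Proof. by move=> v1; rewrite /sieve_level -[4%N]/(2 ^ 2)%N leq_exp2l // sieve_exp_ge2. Qed.

Lemma sum_small_primes (P : pred nat) (v : nat) : (1 < v)%N ->
  \sum_(0 <= l < (sieve_level v).+1 | prime l && P l) l%:R^-1 <=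
    1 + \sum_(l <- sieve_primes v | P l) l%:R^-1 :> R.
Proof.
move=> v1; have z4 := sieve_level_ge4 v1.
rewrite (big_cat_nat (n := 4)) //=; last lia.
rewrite big_filter_cond lerD2r big_mkcond /index_iota /=.
rewrite !big_cons big_nil /=.
by case: (P 2%N); case: (P 3%N); lra.
Qed.

Lemma ln_sieve_level v : (1 < v)%N ->
  [/\ 1 <= ln (sieve_level v)%:R :> R &
      39 * ln (v%:R : R) - 1 <= ln (ln (sieve_level v)%:R)].
Proof.
move=> v1; have v0 : 0 < v%:R :> R by rewrite ltr0n ltnW.
have e : ln (sieve_level v)%:R = (v ^ 39)%:R * ln 2 :> R.
  by rewrite /sieve_level natrX lnXn // mulr_natl.
have l2 := ln2_ge R; have m2 : 2 <= (v ^ 39)%:R :> R by rewrite ler_nat sieve_exp_ge2.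
split; first by rewrite e; nra.
rewrite e natrX lnM ?posrE ?exprn_gt0 //; last lra.
rewrite lnXn // mulr_natl lerD2l.
have : ln (2^-1 * 2 : R) = 0 by rewrite mulVf // ln1.
have : ln (ln 2) >= ln (2^-1 : R) by rewrite ler_ln // posrE; lra.
have : ln (2 : R) <= 1 by have := @le_ln1Dx R 1; rewrite -[1 + 1]/2; apply; lra.
rewrite lnV ?posrE //; lra.
Qed.

Lemma sieve_sum_ge v : (1 < v)%N ->
  39 * ln (v%:R : R) - 3 <= \sum_(l <- sieve_primes v) l%:R^-1.
Proof.
move=> v1; have [l1 l2] := ln_sieve_level v1.
have := sum_small_primes xpredT v1.
have := ln_le_expR_sum_primes R (sieve_level v).
under [in X in _ -> X -> _]eq_bigl => l do rewrite andbT.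
set T := \sum_(0 <= l < _ | _) _ => h hT.
have : ln (sieve_level v)%:R <= expR (1 + T).
  apply: le_trans h; rewrite ler_ln ?posrE ?ltr0n ?ler_nat //.
  exact: leq_trans (sieve_level_ge4 v1).
rewrite -ler_ln ?posrE ?expR_gt0 ?expRK //; last lra.
lra.
Qed.

Lemma sieve_sum_le v : (1 < v)%N ->
  \sum_(l <- sieve_primes v) l%:R^-1 <= 3 + 78 * ln (v%:R : R).
Proof.
move=> v1; have m2 := sieve_exp_ge2 v1.
have := sum_primes_dyadic_le R (v ^ 39).-1.
have m0 : (0 < v ^ 39)%N := ltnW m2.
rewrite prednK //.
have := harm_le_ln R m0.
rewrite natrX lnXn ?ltr0n ?(ltnW v1) //.
rewrite -[_ *+ 39]mulr_natl.
have : harm R (v ^ 39).-1 <= harm R (v ^ 39).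
  by rewrite -{2}(prednK m0) harmS lerDl invr_ge0.
have : \sum_(l <- sieve_primes v) l%:R^-1 <=
    \sum_(0 <= l < (sieve_level v).+1 | prime l) l%:R^-1 :> R.
  rewrite big_filter [leRHS](big_cat_nat (n := 4)) //=; last first.
    by have := sieve_level_ge4 v1; lia.
  by rewrite lerDr sumr_ge0.
rewrite /sieve_level; lra.
Qed.

Lemma sieve_sum_mod3_ge v : (1 < v)%N ->
  39 / 2 * ln (v%:R : R) - 4 <=
    \sum_(l <- sieve_primes v | (l %% 3 == 2)%N) l%:R^-1.
Proof.
move=> v1; have [l1 l2] := ln_sieve_level v1; have z4 := sieve_level_ge4 v1.
have z1 : (1 < sieve_level v)%N by lia.
have := ln_le_expR_sum_primes_mod3 R z1.
have := sum_small_primes (fun l => l %% 3 != 1)%N v1.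
have -> : \sum_(l <- sieve_primes v | (l %% 3 != 1)%N) l%:R^-1 =
    \sum_(l <- sieve_primes v | (l %% 3 == 2)%N) l%:R^-1 :> R.
  rewrite big_seq_cond [RHS]big_seq_cond; apply: eq_bigl => l.
  case: (boolP (l \in _)) => //= /sieve_primesP[pl l3 _].
  have : ~~ (3 %| l)%N by rewrite dvdn_prime2 //; lia.
  by rewrite /dvdn; lia.
set T := \sum_(0 <= l < _ | _) _; set y := ln (sieve_level v)%:R in l1 l2 *.
move=> hT hy.
(* Since [y >= 1], [1 + 2 y <= 3 y], and one factor [y] cancels. *)
have : y <= expR (2 + 2 * T) * 3.
  have e0 := expR_gt0 (2 + 2 * T); nra.
rewrite -ler_ln ?posrE ?mulr_gt0 ?expR_gt0 //; last lra.
rewrite lnM ?posrE ?expR_gt0 // expRK.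
have : ln (3 : R) <= 2.
  have := @le_ln1Dx R 2; rewrite (_ : 1 + 2 = 3); last by ring.
  by apply; lra.
lra.
Qed.

Lemma natr_expn_le_expR n : exists2 C : R, 0 < C &
  forall v : nat, v%:R ^+ n <= C * expR v%:R.
Proof.
exists (n`!%:R); first by rewrite ltr0n fact_gt0.
case: n => [|n] v; first by rewrite expr0 mul1r -[leLHS]expR0 ler_expR.
have := expR_ge1Dxn n (ler0n R v).
rewrite -ler_pdivrMl ?ltr0n ?fact_gt0 // mulrC; lra.
Qed.

Lemma expR_lnM_natr n v : (0 < v)%N ->
  expR (n%:R * ln (v%:R : R)) = v%:R ^+ n.
Proof. by move=> v0; rewrite expRM_natl lnK // posrE ltr0n. Qed.

(** [(2 x)^(n+1) / (n+1)!] is a term of the series of [exp (2 x)], and [2^(n+1)] becomes decay in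
    [n]. *)
Lemma expf_fact_le (x : R) n : 0 <= x ->
  x ^+ n.+1 / (n.+1)`!%:R <= expR (2 * x - n.+1%:R * ln 2).
Proof.
move=> x0; have x20 : 0 <= 2 * x by lra.
have := expR_ge1Dxn n x20.
rewrite expRB (expRM_natl n.+1) lnK ?posrE // ler_pdivlMr ?exprn_gt0 // exprMn => h.
apply: le_trans (_ : 1 + 2 ^+ n.+1 * x ^+ n.+1 / (n.+1)`!%:R <= _) => //.
by rewrite mulrAC -mulrA mulrCA mulrA; lra.
Qed.

(** At order [2 v] the truncation error is [exp (O(ln v) - (2 v + 1) ln 2)], the sieved sums being
    [O(ln v)], and the rounding error is at most [2^(-2 v) N]. Both beat any power of [v]; 80
    exceeds the largest exponent needed below, [10 + 42]. *)
Lemma brun_sieve_level : exists2 C : R, 0 < C &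
  forall (v N : nat) (h : nat -> nat -> R) (c : nat -> R),
  (1 < v)%N -> (2 ^ (4 * v ^ 40) <= N)%N ->
  {in sieve_primes v, forall l, [/\ forall n, 0 <= h l n <= 1,
    periodic l (h l), \sum_(n < l) h l n = c l & c l <= 2]} ->
  \sum_(n < N) \prod_(l <- sieve_primes v) (1 - h l n) <=
    N%:R * (expR (- \sum_(l <- sieve_primes v) c l / l%:R) +
            C * expR (- (80 * ln v%:R))).
Proof.
(* 312 comes from [2 A <= 12 + 312 ln v], and 80 is the saving. *)
have [C1 C10 hC1] := natr_expn_le_expR (312 + 80).
have [C2 C20 hC2] := natr_expn_le_expR 80.
exists (expR 12 * C1 + C2); first by rewrite addr_gt0 // mulr_gt0 // expR_gt0.
move=> v N h c v1 vN hs.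
have v0 : (0 < v)%N := ltnW v1.
have er : ~~ odd (2 * v) by rewrite mul2n odd_double.
have := brun_sieve N (sieve_primes_uniq v) (sieve_primes_prime v) er hs.
set A := \sum_(l <- _) c l / _; set s := sieve_primes v => /le_trans; apply.
rewrite !mulrDr -addrA lerD2l.
have c02 l : l \in s -> 0 <= c l <= 2.
  by move=> /hs[h01 _ <- ->]; rewrite andbT sumr_ge0 // => n _; case/andP: (h01 n).
have A0 : 0 <= A.
  by rewrite /A big_seq sumr_ge0 // => l /c02/andP[? _]; rewrite divr_ge0.
have AS : A <= 6 + 156 * ln v%:R.
  apply: le_trans (_ : 2 * \sum_(l <- s) l%:R^-1 <= _); last first.
    by have := sieve_sum_le v1; rewrite -/s; lra.
  rewrite mulr_sumr /A big_seq [leRHS]big_seq; apply: ler_sum => l /c02/andP[_ c2].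
  by rewrite ler_wpM2r // invr_ge0.
have l2 := ln2_ge R.
have vR : 0 <= v%:R :> R by [].
have tail : A ^+ (2 * v).+1 / ((2 * v).+1)`!%:R <=
    expR 12 * C1 * expR (- (80 * ln v%:R)).
  apply: le_trans (expf_fact_le _ A0) _.
  apply: le_trans (_ : expR 12 * (expR ((312 + 80)%:R * ln v%:R) *
      expR (- v%:R)) * expR (- (80 * ln v%:R)) <= _).
    rewrite -!expRD ler_expR (natrD _ 312) -[(2 * v).+1%:R]natr1 (natrM _ 2 v).
    have : (2 * v%:R + 1) * 2^-1 <= (2 * v%:R + 1) * ln 2 :> R.
      by rewrite ler_wpM2l //; lra.
    lra.
  rewrite ler_wpM2r ?expR_ge0 // ler_wpM2l ?expR_ge0 //.
  rewrite expR_lnM_natr // expRN ler_pdivrMr ?expR_gt0 //; exact: hC1.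
have size_s : 1 + 2 * (size s)%:R <= (2 ^ (v ^ 39).+1)%:R :> R.
  rewrite -natrM -(natrD _ 1) ler_nat expnS -/(sieve_level v).
  have : (size s <= size (index_iota 4 (sieve_level v).+1))%N.
    by rewrite size_filter count_size.
  rewrite size_iota; have := sieve_level_ge4 v1; move: (sieve_level v) => z.
  by clear; lia.
have err : (1 + 2 * (size s)%:R) ^+ (2 * v) * (2 ^ (2 * v))%:R <= N%:R :> R.
  apply: le_trans (_ : (2 ^ (4 * v ^ 40))%:R <= _); last by rewrite ler_nat.
  apply: le_trans (_ : ((2 ^ (v ^ 39).+1) ^ (2 * v) * 2 ^ (2 * v))%:R <= _).
    rewrite natrM ler_wpM2r // natrX lerXn2r ?nnegrE //.
  rewrite ler_nat -expnM -expnD leq_exp2l // (expnSr v 39).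
  by have := sieve_exp_ge2 v1; move: (v ^ 39)%N => m; move: v0; clear; nia.
have ev : expR v%:R <= (2 ^ (2 * v))%:R :> R.
  rewrite natrX -[X in X ^+ _](@lnK R 2) ?posrE // -expRM_natl ler_expR natrM.
  have : v%:R * 2^-1 <= v%:R * ln (2 : R) by rewrite ler_wpM2l.
  lra.
rewrite [(_ + C2) * _]mulrDl [leRHS]mulrDr; apply: lerD.
  by rewrite ler_wpM2l.
rewrite expRN mulrA ler_pdivlMr ?expR_gt0 // expR_lnM_natr //.
set X := (_ + _) ^+ _ in err *.
have X0 : 0 <= X by rewrite exprn_ge0 // addr_ge0 ?mulr_ge0.
apply: le_trans (_ : X * (C2 * (2 ^ (2 * v))%:R) <= _).
  rewrite ler_wpM2l //; apply: le_trans (hC2 v) _.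
  by rewrite ler_wpM2l // ltW.
by rewrite mulrCA mulrC ler_wpM2r // ltW.
Qed.
End SieveLevel.

(** * Exceptional integers and primes *)

Section Exceptions.
Variable R : realType.

Lemma sum_dvd_shift l b : (0 < l)%N ->
  \sum_(n < l) (l %| n + b)%N%:R = 1 :> R.
Proof.
move=> l0; have h : ((l - b %% l) %% l < l)%N by rewrite ltn_pmod.
have hb : (l %| (l - b %% l) %% l + b)%N.
  rewrite /dvdn modnDml -modnDmr subnK ?modnn //.
  by rewrite ltnW // ltn_pmod.
rewrite (bigD1 (Ordinal h)) //= hb big1 ?addr0 // => i /eqP ni.
case: (boolP (l %| _)%N) => // ib; case: ni; apply: val_inj => /=.
have : (i + b == (l - b %% l) %% l + b %[mod l])%N.
  by move: ib hb; rewrite /dvdn => /eqP -> /eqP ->.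
by rewrite eqn_modDr modn_mod (modn_small (ltn_ord i)) => /eqP.
Qed.

(** [a] is the weight on [n] itself: 1 when primes are counted, 0 when integers are. For [0 < b < 4]
    no [l > 3] divides both [n] and [n + b], which keeps the total weight in [[0, 1]]; for [b = 0]
    the condition [a = 0] does so. *)
Lemma brun_sieve_shift : exists2 C : R, 0 < C &
  forall (v N b : nat) (a : R) (g : nat -> R),
  (1 < v)%N -> (2 ^ (4 * v ^ 40) <= N)%N -> (b < 4)%N ->
  0 <= a <= 1 -> (b = 0%N -> a = 0) -> (forall l, 0 <= g l <= 1) ->
  \sum_(n < N) \prod_(l <- sieve_primes v)
      (1 - (a * (l %| n)%N%:R + g l * (l %| n + b)%N%:R)) <=
    N%:R * (expR (- \sum_(l <- sieve_primes v) (a + g l) / l%:R) +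
            C * expR (- (80 * ln v%:R))).
Proof.
have [C C0 hC] := brun_sieve_level R; exists C => // v N b a g v1 vN b4 a01 ab g01.
apply: (hC v N (fun l n => a * (l %| n)%N%:R + g l * (l %| n + b)%N%:R)) => //.
move=> l /sieve_primesP[pl l3 _]; have := g01 l => gl; split.
- move=> n; case: (boolP (l %| n)%N) => ln; case: (boolP (l %| n + b)%N) => lb /=; try lra.
  have : (l %| b)%N by rewrite -(dvdn_addr _ ln).
  case: b ab b4 {lb} => [->// _ _|b _ b4]; first by lra.
  by move/dvdn_leq => /(_ isT); move: l3 b4; clear; lia.
- by move=> n /=; rewrite addnAC !(dvdn_addl _ (dvdnn l)).
- rewrite big_split /= -!mulr_sumr sum_dvd_shift ?prime_gt0 // mulr1.
  under eq_bigr => n _ do rewrite -[X in (_ %| X)%N]addn0.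
  by rewrite sum_dvd_shift ?prime_gt0 // mulr1.
- lra.
Qed.

Definition omega (v n : nat) := count (fun l => l %| n)%N (sieve_primes v).

(** Each prime factor contributes [2/3 >= exp (-1/2)]. *)
Lemma expR_omega_le v n :
  expR (- ((omega v n)%:R / 2)) <=
  \prod_(l <- sieve_primes v) (1 - 3^-1 * (l %| n)%N%:R) :> R.
Proof.
rewrite /omega; elim: (sieve_primes v) => [|l s IH].
  by rewrite big_nil /= mul0r oppr0 expR0.
rewrite big_cons /= natrD mulrDl opprD expRD; apply: ler_pM => //; rewrite ?expR_ge0 //.
case: (l %| n)%N => /=; last by rewrite mul0r oppr0 expR0; lra.
rewrite expRN -[leRHS]invrK lef_pV2 ?posrE ?expR_gt0 ?invr_gt0 //; last lra.
apply: le_trans (expR_ge1Dx _).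
by rewrite -[leLHS]mul1r ler_pdivrMr; lra.
Qed.

(** Rankin's trick: the indicator of having few prime factors is majorised by a product over primes,
    to which the sieve applies. *)
Lemma few_primes_le v n (K : R) : (omega v n)%:R <= K ->
  1 <= expR (K / 2) * \prod_(l <- sieve_primes v) (1 - 3^-1 * (l %| n)%N%:R).
Proof.
move=> h; apply: le_trans (ler_wpM2l (expR_ge0 _) (expR_omega_le v n)).
rewrite -expRD -[leLHS]expR0 ler_expR; lra.
Qed.

Definition has_prime_2mod3 (v n : nat) :=
  has (fun l => (l %% 3 == 2) && (l %| n))%N (sieve_primes v).

Lemma no_prime_2mod3_prod v n : ~~ has_prime_2mod3 v n ->
  \prod_(l <- sieve_primes v)
    (1 - (l %% 3 == 2)%N%:R * (l %| n)%N%:R) = 1 :> R.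
Proof.
move=> /hasPn h; rewrite big_seq big1 // => l /h.
by case: eqP => //= _; [move=> /negbTE ->; rewrite mulr0 subr0|rewrite mul0r subr0].
Qed.

Lemma sieve_prod_ge0 v n m (a : R) (g : nat -> R) :
  (a = 0 \/ exists2 b, (0 < b < 4)%N & m = (n + b)%N) ->
  0 <= a <= 1 -> (forall l, 0 <= g l <= 1) ->
  0 <= \prod_(l <- sieve_primes v) (1 - (a * (l %| n)%N%:R + g l * (l %| m)%N%:R)).
Proof.
move=> hm a01 g01; rewrite big_seq prodr_ge0 // => l /sieve_primesP[_ l3 _].
have := g01 l; case: (boolP (l %| n)%N) => ln; case: (boolP (l %| m)%N) => lm /=; try lra.
case: hm => [->|[b b4 mE]]; first by lra.
move: lm; rewrite mE dvdn_addr // => /dvdn_leq; lia.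
Qed.

(** No prime of the sieve divides a prime above the sieve level, so sieving [p] too leaves its
    weight unchanged. *)
Lemma large_prime_prod v p m (g : nat -> R) : prime p -> (sieve_level v < p)%N ->
  \prod_(l <- sieve_primes v) (1 - (1 * (l %| p)%N%:R + g l * (l %| m)%N%:R)) =
  \prod_(l <- sieve_primes v) (1 - g l * (l %| m)%N%:R).
Proof.
move=> pp zp; rewrite big_seq [RHS]big_seq; apply: eq_bigr => l.
move=> /sieve_primesP[pl _ lz]; rewrite dvdn_prime2 //.
by rewrite (_ : (l == p) = false) ?mulr0 ?add0r //; apply/eqP; lia.
Qed.

(* This is [1 + (40 ln v + 42) / 2], and [ln ln N <= 40 ln v + 42] by [ln_block]. *)
Definition omega_threshold (v : nat) : R := 20 * ln v%:R + 22.

Lemma sieve_sum_third_ge v : (1 < v)%N ->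
  13 * ln (v%:R : R) - 1 <= \sum_(l <- sieve_primes v) (0 + 3^-1) / l%:R.
Proof. by move=> v1; rewrite -mulr_sumr; have := sieve_sum_ge R v1; lra. Qed.

Lemma sieve_sum_2mod3 v :
  \sum_(l <- sieve_primes v | (l %% 3 == 2)%N) l%:R^-1 =
  \sum_(l <- sieve_primes v) (l %% 3 == 2)%N%:R / l%:R :> R.
Proof.
by rewrite big_mkcond; apply: eq_bigr => l _; case: ifP; rewrite ?mul1r ?mul0r.
Qed.

Definition exceptional (v n : nat) : bool :=
  ((omega v n)%:R <= omega_threshold v) || ~~ has_prime_2mod3 v n.

(** Put [L = ln v]. For few prime factors, [exp (10 L + 11)] meets the sieve bound
    [exp (- 13 L + 1)], leaving [exp (- 3 L)] up to a constant. For no factor [2 mod 3], the main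
    term is at most [exp (- 39/2 L + 4)]. *)
Lemma count_exceptional : exists2 C : R, 0 < C &
  forall v N : nat, (1 < v)%N -> (2 ^ (4 * v ^ 40) <= N)%N ->
  (\sum_(n < N) exceptional v n)%:R <= C * N%:R * expR (- (3 * ln v%:R)).
Proof.
have [C C0 hC] := brun_sieve_shift.
exists (expR 11 * (expR 1 + C) + (expR 4 + C)).
  by rewrite addr_gt0 ?mulr_gt0 ?addr_gt0 ?expR_gt0.
move=> v N v1 vN.
pose w1 n : R := \prod_(l <- sieve_primes v)
  (1 - (0 * (l %| n)%N%:R + 3^-1 * (l %| n + 0)%N%:R)).
pose w2 n : R := \prod_(l <- sieve_primes v)
  (1 - (0 * (l %| n)%N%:R + (l %% 3 == 2)%N%:R * (l %| n + 0)%N%:R)).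
have b01 (c : bool) : 0 <= (c%:R : R) <= 1 by case: c; rewrite /= ?lexx ?ler01.
have t01 : 0 <= (3^-1 : R) <= 1 by lra.
have z01 : 0 <= (0 : R) <= 1 by rewrite lexx ler01.
have le_w n : (exceptional v n)%:R <= expR (omega_threshold v / 2) * w1 n + w2 n.
  have w1E : w1 n = \prod_(l <- sieve_primes v) (1 - 3^-1 * (l %| n)%N%:R).
    by apply: eq_bigr => l _; rewrite mul0r add0r addn0.
  have w2E : w2 n = \prod_(l <- sieve_primes v)
      (1 - (l %% 3 == 2)%N%:R * (l %| n)%N%:R).
    by apply: eq_bigr => l _; rewrite mul0r add0r addn0.
  have w10 : 0 <= w1 n by apply: sieve_prod_ge0 => //; left.
  have w20 : 0 <= w2 n by apply: sieve_prod_ge0 => //; left.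
  have e0 := expR_ge0 (omega_threshold v / 2).
  rewrite /exceptional; case: (boolP ((omega v n)%:R <= _)) => [/few_primes_le|_] /=.
    by rewrite -w1E; lra.
  case: (boolP (has_prime_2mod3 v n)) => [_|/no_prime_2mod3_prod] /=.
    by rewrite addr_ge0 // mulr_ge0.
  by rewrite -w2E => ->; rewrite lerDr mulr_ge0.
rewrite natr_sum; apply: le_trans (ler_sum _ (fun (n : 'I_N) _ => le_w n)) _.
rewrite big_split /= -mulr_sumr.
have h1 := hC v N 0%N 0 (fun=> 3^-1) v1 vN isT z01 (fun=> erefl) (fun=> t01).
have h2 := hC v N 0%N 0 (fun l => (l %% 3 == 2)%N%:R) v1 vN isT z01 (fun=> erefl)
  (fun l => b01 _).
have s1 := sieve_sum_third_ge v1.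
have s2 : 39 / 2 * ln v%:R - 4 <=
    \sum_(l <- sieve_primes v) (0 + (l %% 3 == 2)%N%:R) / l%:R :> R.
  under eq_bigr => l _ do rewrite add0r.
  by rewrite -sieve_sum_2mod3 sieve_sum_mod3_ge.
have N0 : 0 <= N%:R :> R by [].
have lv0 : 0 <= ln (v%:R : R) by rewrite ln_ge0 // ler1n ltnW.
set L := ln (v%:R : R) in h1 h2 s1 s2 lv0 *.
rewrite /omega_threshold -/L.
apply: le_trans (lerD (ler_wpM2l (expR_ge0 _) h1) h2) _.
set S1 := \sum_(l <- _) _ in s1 *; set S2 := \sum_(l <- _) _ in s2 *.
have a1 : expR ((20 * L + 22) / 2) * (expR (- S1) + C * expR (- (80 * L))) <=
    expR 11 * (expR 1 + C) * expR (- (3 * L)).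
  rewrite (_ : (20 * L + 22) / 2 = 11 + 10 * L); last by field.
  rewrite expRD -!mulrA ler_wpM2l ?expR_ge0 // !mulrDr !mulrDl -!expRD.
  apply: lerD; first by rewrite ler_expR; lra.
  by rewrite mulrCA ler_wpM2l ?(ltW C0) // -expRD ler_expR; lra.
have a2 : expR (- S2) + C * expR (- (80 * L)) <= (expR 4 + C) * expR (- (3 * L)).
  rewrite [leRHS]mulrDl -[expR _ * expR _]expRD; apply: lerD.
    by rewrite ler_expR; lra.
  by rewrite ler_wpM2l ?(ltW C0) // ler_expR; lra.
have b1 := ler_wpM2l N0 a1; have b2 := ler_wpM2l N0 a2.
rewrite [X in X + _]mulrCA; apply: le_trans (lerD b1 b2) _.
by rewrite le_eqVlt; apply/orP; left; apply/eqP; ring.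
Qed.

(** The construction uses [p + 1] if [p = 3 mod 4] and [p + 3] if [p = 1 mod 4]; controlling both
    avoids splitting the count by residue classes. *)
Definition exceptional_prime (v p : nat) : bool :=
  prime p && [|| (omega v (p + 1))%:R <= omega_threshold v,
    (omega v (p + 3))%:R <= omega_threshold v | ~~ has_prime_2mod3 v (p + 3)].

(** Sieving [n] as well adds 39 to the exponents of [v]: [39 (1 + 1/3) - 10 = 42] for few prime
    factors, [39 + 39/2] for none [2 mod 3]. The saving [v^(-42)] beats the density of primes, of
    order [v^(-40)]. Primes up to the sieve level are left out, as the sieve removes them. *)
Lemma count_exceptional_prime : exists2 C : R, 0 < C &
  forall v N : nat, (1 < v)%N -> (2 ^ (4 * v ^ 40) <= N)%N ->
  (\sum_(n < N | (sieve_level v < n)%N) exceptional_prime v n)%:R <=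
     C * N%:R * expR (- (42 * ln v%:R)).
Proof.
have [C C0 hC] := brun_sieve_shift.
exists (2 * (expR 11 * (expR 4 + C)) + (expR 7 + C)).
  by rewrite addr_gt0 ?mulr_gt0 ?addr_gt0 ?expR_gt0 ?mulr_gt0 ?addr_gt0 ?expR_gt0.
move=> v N v1 vN.
pose w1 b n : R := \prod_(l <- sieve_primes v)
  (1 - (1 * (l %| n)%N%:R + 3^-1 * (l %| n + b)%N%:R)).
pose w2 n : R := \prod_(l <- sieve_primes v)
  (1 - (1 * (l %| n)%N%:R + (l %% 3 == 2)%N%:R * (l %| n + 3)%N%:R)).
have b01 (c : bool) : 0 <= (c%:R : R) <= 1 by case: c; rewrite /= ?lexx ?ler01.
have t01 : 0 <= (3^-1 : R) <= 1 by lra.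
have z01 : 0 <= (1 : R) <= 1 by rewrite lexx ler01.
pose E := expR (omega_threshold v / 2).
have w10 b n : (0 < b < 4)%N -> 0 <= w1 b n.
  by move=> hb; apply: sieve_prod_ge0 => //; right; exists b.
have w20 n : 0 <= w2 n by apply: sieve_prod_ge0 => //; right; exists 3%N.
have E0 : 0 <= E := expR_ge0 _.
have le_w n : (if (sieve_level v < n)%N then (exceptional_prime v n)%:R else 0)
    <= E * w1 1%N n + E * w1 3%N n + w2 n.
  have W0 : 0 <= E * w1 1%N n + E * w1 3%N n + w2 n.
    by rewrite !addr_ge0 // mulr_ge0 // w10.
  case: ifP => // zn; rewrite /exceptional_prime.
  case: (boolP (prime n)) => //= pn.
  have w1E b : w1 b n = \prod_(l <- sieve_primes v) (1 - 3^-1 * (l %| n + b)%N%:R).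
    exact: large_prime_prod.
  have w2E : w2 n = \prod_(l <- sieve_primes v)
      (1 - (l %% 3 == 2)%N%:R * (l %| n + 3)%N%:R).
    exact: (large_prime_prod _ (fun l => (l %% 3 == 2)%N%:R)).
  have e1 : 0 <= E * w1 1%N n by rewrite mulr_ge0 // w10.
  have e3 : 0 <= E * w1 3%N n by rewrite mulr_ge0 // w10.
  have := w20 n.
  case: (boolP ((omega v (n + 1))%:R <= _)) => [/few_primes_le|_] /=.
    by rewrite -w1E -/E; lra.
  case: (boolP ((omega v (n + 3))%:R <= _)) => [/few_primes_le|_] /=.
    by rewrite -w1E -/E; lra.
  case: (boolP (has_prime_2mod3 v _)) => [_|/no_prime_2mod3_prod] /=.
    by lra.
  by rewrite -w2E; lra.
rewrite natr_sum big_mkcond /=.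
apply: le_trans (ler_sum _ (fun (n : 'I_N) _ => le_w n)) _.
rewrite !big_split /= -!mulr_sumr.
have n0 (b : nat) : b.+1 = 0%N -> 1 = 0 :> R by [].
have h1 := hC v N 1%N 1 (fun=> 3^-1) v1 vN isT z01 (n0 _) (fun=> t01).
have h3 := hC v N 3%N 1 (fun=> 3^-1) v1 vN isT z01 (n0 _) (fun=> t01).
have h2 := hC v N 3%N 1 (fun l => (l %% 3 == 2)%N%:R) v1 vN isT z01 (n0 _)
  (fun l => b01 _).
have s0 := sieve_sum_ge R v1.
have s1 : 52 * ln v%:R - 4 <= \sum_(l <- sieve_primes v) (1 + 3^-1) / l%:R :> R.
  by rewrite -mulr_sumr; lra.
have s2 : 117 / 2 * ln v%:R - 7 <=
    \sum_(l <- sieve_primes v) (1 + (l %% 3 == 2)%N%:R) / l%:R :> R.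
  under eq_bigr => l _ do rewrite mulrDl mul1r.
  by rewrite big_split /= -sieve_sum_2mod3; have := sieve_sum_mod3_ge R v1; lra.
have N0 : 0 <= N%:R :> R by [].
have lv0 : 0 <= ln (v%:R : R) by rewrite ln_ge0 // ler1n ltnW.
rewrite /E; set L := ln (v%:R : R) in h1 h2 h3 s0 s1 s2 lv0 *.
rewrite /omega_threshold -/L.
apply: le_trans (lerD (lerD (ler_wpM2l (expR_ge0 _) h1)
  (ler_wpM2l (expR_ge0 _) h3)) h2) _.
set S1 := \sum_(l <- _) _ in s1 *; set S2 := \sum_(l <- _) _ in s2 *.
have a1 : expR ((20 * L + 22) / 2) * (expR (- S1) + C * expR (- (80 * L))) <=
    expR 11 * (expR 4 + C) * expR (- (42 * L)).
  rewrite (_ : (20 * L + 22) / 2 = 11 + 10 * L); last by field.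
  rewrite expRD -!mulrA ler_wpM2l ?expR_ge0 // !mulrDr !mulrDl -!expRD.
  apply: lerD; first by rewrite ler_expR; lra.
  by rewrite mulrCA ler_wpM2l ?(ltW C0) // -expRD ler_expR; lra.
have a2 : expR (- S2) + C * expR (- (80 * L)) <= (expR 7 + C) * expR (- (42 * L)).
  rewrite [leRHS]mulrDl -[expR _ * expR _]expRD; apply: lerD.
    by rewrite ler_expR; lra.
  by rewrite ler_wpM2l ?(ltW C0) // ler_expR; lra.
have b1 := ler_wpM2l N0 a1; have b2 := ler_wpM2l N0 a2.
rewrite [expR _ * (N%:R * _)]mulrCA; apply: le_trans (lerD (lerD b1 b1) b2) _.
by rewrite le_eqVlt; apply/orP; left; apply/eqP; ring.
Qed.

End Exceptions.

(** * Primorials *)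

Section Primorial.
Variable R : realType.

Definition primes_to (m : nat) := [seq p <- index_iota 1 m.+1 | prime p].

Definition primorial (m : nat) := (\prod_(p <- primes_to m) p)%N.

Lemma primes_to_gt1 m : all (leq 2) (primes_to m).
Proof. by apply/allP => p; rewrite mem_filter => /andP[/prime_gt1]. Qed.

Lemma primorial_ge m : (2 ^ size (primes_to m) <= primorial m)%N.
Proof. exact: leq_expn_prod (primes_to_gt1 m). Qed.

Lemma primorial_gt0 m : (0 < primorial m)%N.
Proof. by apply: leq_trans (primorial_ge m); rewrite expn_gt0. Qed.

Lemma primorial_le m : (primorial m <= m ^ size (primes_to m))%N.
Proof.
rewrite /primorial; have : all (fun p => p <= m)%N (primes_to m).
  by apply/allP => p; rewrite mem_filter mem_index_iota ltnS => /and3P[].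
elim: (primes_to m) => [|p s IH] /=; first by rewrite big_nil.
by move=> /andP[pm sm]; rewrite big_cons expnS leq_mul // IH.
Qed.

Lemma primorial_dvd m p : prime p -> (p <= m)%N -> (p %| primorial m)%N.
Proof.
move=> pp pm; rewrite /primorial (big_rem p) /= ?dvdn_mulr //.
by rewrite mem_filter pp mem_index_iota prime_gt0.
Qed.

Lemma primorial_leq m m' : (m <= m')%N -> (primorial m <= primorial m')%N.
Proof.
move=> mm'; apply: dvdn_leq; first exact: primorial_gt0.
apply: prime_seq_prod_dvd.
- by rewrite filter_uniq // iota_uniq.
- exact: filter_all.
move=> p; rewrite mem_filter mem_index_iota ltnS => /and3P[pp _ pm].
by apply: primorial_dvd => //; apply: leq_trans mm'.
Qed.

Lemma es_count_primorial m : (2 <= m)%N ->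
  (3 ^ (size (primes_to m) - 2) <= es_count (primorial m))%N.
Proof.
move=> m2; set s := [seq p <- primes_to m | (3 < p)%N].
have us : uniq s by rewrite !filter_uniq // iota_uniq.
have sz : (size (primes_to m) - 2 <= size s)%N.
  rewrite leq_subLR -(count_predC (fun p => 3 < p)%N (primes_to m)) -size_filter addnC.
  rewrite -/s leq_add2r -size_filter -[2%N]/(size [:: 2; 3])%N.
  apply: uniq_leq_size; first by rewrite !filter_uniq // iota_uniq.
  move=> p; rewrite mem_filter /= -leqNgt mem_filter !inE => /and3P[p3 pp _].
  by move: pp p3; case: p => [|[|[|[|p]]]].
apply: leq_trans (leq_pexp2l _ sz) _ => //; apply: es_count_even => //.
- exact: primorial_gt0.
- by rewrite -dvdn2 primorial_dvd.
- by apply/allP => p; rewrite mem_filter mem_filter => /and3P[-> ->].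
- move=> p; rewrite mem_filter mem_filter mem_index_iota ltnS.
  by move=> /and4P[_ pp _ pm]; apply: primorial_dvd.
Qed.

Lemma size_primes_to_ge m : (0 < m)%N ->
  m%:R / 2 <= (size (primes_to (2 * m)))%:R * ln (2 * m)%:R :> R.
Proof.
move=> m0; have := chebyshev_lower m0; rewrite -/(primes_to _).
set s := size _ => h.
have : ln ((2 ^ m)%:R : R) <= ln ((2 * m) ^ s)%:R.
  by rewrite ler_ln ?posrE ?ltr0n ?ler_nat ?expn_gt0 ?muln_gt0 ?m0.
rewrite !natrX !lnXn ?ltr0n ?muln_gt0 ?m0 //.
rewrite -[ln _ *+ m]mulr_natl -[ln _ *+ s]mulr_natl; apply: le_trans.
by rewrite ler_wpM2l // ln2_ge.
Qed.

(** The logarithm of the cutoff is of order [k^2], while the losses in [ln ln n] are [O(k)]; hence a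
    relative error [O(1/k)]. *)
Definition pow_primorial (k : nat) := primorial (2 * 2 ^ (k ^ 2)).

(** With [P] the number of primes up to the cutoff and [Y] the logarithm of the cutoff,
    [ln n <= P Y], [ln ln n >= Y - ln Y - 3] and [ln (es_count n) >= (P - 2) ln 3]. *)
Lemma es_count_pow_primorial k : (10 <= k)%N ->
  (k <= pow_primorial k)%N /\
  expR ((ln 3 - 28 / k%:R) * (ln (pow_primorial k)%:R / loglog R (pow_primorial k))) <=
    (es_count (pow_primorial k))%:R.
Proof.
move=> k10; have m0 : (0 < 2 ^ (k ^ 2))%N by rewrite expn_gt0.
have := size_primes_to_ge m0.
set n := pow_primorial k; pose P := size (primes_to (2 * 2 ^ (k ^ 2))).
rewrite -/P; set Y := ln (2 * 2 ^ (k ^ 2))%:R => hP.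
have kR : 10 <= k%:R :> R by rewrite ler_nat.
have kk : 10 * k%:R <= k%:R ^+ 2 :> R by rewrite expr2 ler_wpM2r.
have l2 := ln2_ge R.
have l21 : ln (2 : R) <= 1 by have := @le_ln1Dx R 1; rewrite -[1 + 1]/2; apply; lra.
have YE : Y = (k%:R ^+ 2 + 1) * ln 2.
  by rewrite /Y -expnS natrX lnXn // -[ln _ *+ _]mulr_natl -[(k ^ 2).+1%:R]natr1 natrX.
have Y1 : k%:R ^+ 2 / 2 <= Y by rewrite YE; nra.
have Y2 : Y <= (1 + k%:R) ^+ 2 by rewrite YE; nra.
have Y0 : 0 < Y by nra.
have lY : ln Y <= 2 * k%:R.
  apply: le_trans (_ : ln ((1 + k%:R) ^+ 2) <= _).
    by rewrite ler_ln ?posrE // exprn_gt0 //; lra.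
  rewrite lnXn; last lra.
  by rewrite -[ln _ *+ 2]mulr_natl ler_wpM2l // le_ln1Dx //; lra.
have m0R : 0 < (2 ^ (k ^ 2))%:R :> R by rewrite ltr0n.
have P0 : 0 < P%:R :> R by nra.
have lP : Y - ln Y - 2 <= ln (P%:R : R).
  have : ln ((2 ^ (k ^ 2))%:R / 2 : R) <= ln (P%:R * Y).
    by rewrite ler_ln ?posrE ?mulr_gt0 ?divr_gt0.
  rewrite ln_div ?posrE // lnM ?posrE //.
  by rewrite /Y natrM lnM ?posrE //; lra.
(* As [ln P < P], [lP] gives [P > k^2/2 - 2 k - 2], which exceeds [k^2/4] for [k >= 10]. *)
have P1 : k%:R ^+ 2 / 4 <= P%:R :> R.
  have := ln_sublinear P0; lra.
have nP : P%:R / 2 <= ln (n%:R : R).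
  apply: le_trans (_ : ln (2 ^ P)%:R <= _).
    by rewrite natrX lnXn // -[ln _ *+ P]mulr_natl ler_wpM2l.
  by rewrite ler_ln ?posrE ?ltr0n ?expn_gt0 ?primorial_gt0 // ler_nat primorial_ge.
have nY : ln (n%:R : R) <= P%:R * Y.
  apply: le_trans (_ : ln ((2 * 2 ^ (k ^ 2)) ^ P)%:R <= _).
    rewrite ler_ln ?posrE ?ltr0n ?primorial_gt0 ?ler_nat ?primorial_le //.
    by rewrite expn_gt0 muln_gt0 m0.
  by rewrite natrX lnXn ?ltr0n ?muln_gt0 // -[ln _ *+ P]mulr_natl.
split.
  rewrite -(ler_nat R); apply: le_trans (_ : ln (n%:R : R) <= _); first nra.
  by rewrite ltW // ln_sublinear // ltr0n primorial_gt0.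
have llP : Y - ln Y - 3 <= loglog R n.
  have : ln (P%:R / 2 : R) <= ln (ln n%:R) by rewrite ler_ln ?posrE //; lra.
  rewrite ln_div ?posrE // /loglog; lra.
have m2 : (2 <= 2 * 2 ^ (k ^ 2))%N by rewrite leq_pmulr.
have es : ln (3 : R) * (P%:R - 2) <= ln (es_count n)%:R.
  have p2 : (2 <= P)%N by rewrite -(ler_nat R); nra.
  have h := es_count_primorial m2.
  apply: le_trans (_ : ln (3 ^ (P - 2))%:R <= _).
    by rewrite natrX lnXn // -[ln _ *+ (P - 2)]mulr_natl natrB // mulrC.
  by rewrite ler_ln ?posrE ?ltr0n ?expn_gt0 ?ler_nat // (leq_trans _ h) // expn_gt0.
have l3 : 0 < ln (3 : R) <= 2.
  rewrite ln_gt0 /=; last lra.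
  have := @le_ln1Dx R 2; rewrite (_ : 1 + 2 = 3); last by ring.
  by apply; lra.
have es0 : 0 < (es_count n)%:R :> R.
  by rewrite ltr0n; apply: leq_trans (es_count_primorial m2); rewrite expn_gt0.
rewrite -[leRHS](@lnK R) ?posrE // ler_expR.
apply: le_trans es.
set D := loglog R n in llP *.
have D0 : 0 < D by nra.
have lnn0 : 0 < ln (n%:R : R) by lra.
rewrite mulrA ler_pdivrMr //.
have [neg|pos] := leP (ln (3 : R) - 28 / k%:R) 0.
  apply: le_trans (_ : 0 <= _); first by rewrite mulr_le0_ge0 // ltW.
  rewrite !mulr_ge0 ?(ltW D0) //; [lra|nra].
apply: le_trans (_ : (ln 3 - 28 / k%:R) * (P%:R * Y) <= _).
  by rewrite ler_wpM2l // ltW.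
apply: le_trans (_ : ln 3 * (P%:R - 2) * (Y - 2 * k%:R - 3) <= _); last first.
  rewrite ler_wpM2l //; last lra.
  by rewrite mulr_ge0 //; [lra|nra].
have k0 : 0 < k%:R :> R by lra.
have t : k%:R * (28 / k%:R) = 28 :> R by field; rewrite gt_eqF.
set q := 28 / k%:R in pos t *.
(* The constant 28 is chosen here: [q Y >= 14 k] and [q P >= 7 k], so each half of [q P Y] dominates
   one term, as [ln 3 <= 2]. *)
have : ln (3 : R) * (2 * Y + (2 * k%:R + 3) * P%:R) <= q * (P%:R * Y).
  have qY : 14 * k%:R <= q * Y by nra.
  have qP : 7 * k%:R <= q * P%:R by nra.
  have PY : 7 * k%:R * P%:R <= q * P%:R * Y / 2 by nra.
  have YP : 7 / 2 * k%:R * Y <= q * P%:R * Y / 2 by nra.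
  have a1 : ln (3 : R) * (2 * Y) <= 7 / 2 * k%:R * Y by nra.
  have a2 : ln (3 : R) * ((2 * k%:R + 3) * P%:R) <= 7 * k%:R * P%:R.
    rewrite mulrA ler_wpM2r //; nra.
  by rewrite mulrDr; lra.
by nra.
Qed.

(** [eps] must be a single sequence in [n], whereas the error [28/k] is indexed by [k]. So [kappa n]
    recovers an index: the largest [k <= n] with [pow_primorial k <= n]. *)
Lemma eps_pow_primorial : exists2 eps : nat -> R, eps n @[n --> \oo] --> (0 : R) &
  infinite_set [set n : nat | (0 < n)%N /\
    expR ((ln 3%:R + eps n) * (ln n%:R / loglog R n)) <= (es_count n)%:R].
Proof.
pose kappa n := (\max_(k < n.+1 | (pow_primorial k <= n)%N) k)%N.
have kappa_ge k n : (k <= n)%N -> (pow_primorial k <= n)%N -> (k <= kappa n)%N.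
  move=> kn hk; have kn' : (k < n.+1)%N by [].
  exact: (@leq_bigmax_cond _ (fun i : 'I_n.+1 => (pow_primorial i <= n)%N) (@nat_of_ord _)
    (Ordinal kn')).
exists (fun n => - (28 / (kappa n)%:R)).
  apply/cvgrPdist_le => e e0.
  pose K := (Num.truncn (28 / e)).+1.
  have K0 : 0 < K%:R :> R by rewrite ltr0n.
  have Ke : 28 / K%:R <= e.
    rewrite ler_pdivrMr // mulrC -ler_pdivrMr // ltW //.
    exact: Num.Theory.truncnS_gt.
  near=> n.
  have kn : (K <= kappa n)%N by apply: kappa_ge; near: n; exact: nbhs_infty_ge.
  rewrite sub0r opprK ger0_norm ?divr_ge0 //; apply: le_trans Ke.
  by rewrite ler_wpM2l // lef_pV2 ?posrE ?ler_nat // ltr0n (leq_trans _ kn).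
move=> /finite_fsetP[X XE].
pose k := (maxn 10 (\max_(x <- X) x).+1)%N.
have k10 : (10 <= k)%N by exact: leq_maxl.
have [kn _] := es_count_pow_primorial k10.
have kk := kappa_ge _ _ kn (leqnn _).
(* [kappa] may return an index above [k], but by monotonicity one with the same primorial; the bound
   is applied at that index. *)
have hk : pow_primorial (kappa (pow_primorial k)) = pow_primorial k.
  apply/eqP; rewrite eqn_leq; apply/andP; split.
    rewrite /kappa; elim/big_ind: _ => [|i j hi hj|//].
      by apply: primorial_leq; rewrite leq_mul2l leq_exp2l // leq_exp2r.
    by rewrite /maxn; case: ifP.
  by apply: primorial_leq; rewrite leq_mul2l leq_exp2l // leq_exp2r.
have [_] := es_count_pow_primorial (leq_trans k10 kk); rewrite hk => main.
have : pow_primorial k \in X.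
  have : [set` X] (pow_primorial k) by rewrite -XE; split=> //; exact: primorial_gt0.
  by [].
move=> kX; have := @leq_bigmax_seq nat (enum_fset X) xpredT id (pow_primorial k) kX isT.
rewrite leqNgt => /negP; apply; apply: leq_trans kn; exact: leq_maxr.
Unshelve. all: by end_near.
Qed.

End Primorial.

(** * The target bound *)

Section Density.
Variable R : realType.

(* [exp (- y) >= 1 - y] at [y = 1.098 / 2048], squared eleven times. *)
Lemma ln3_ge : 1098 / 1000 <= ln (3 : R).
Proof.
rewrite -(@expRK R (1098 / 1000)) ler_ln ?posrE ?expR_gt0 //.
pose d (i j k : R) := i / 1000 + j / (1000 * 1000) + k / (1000 * 1000 * 1000).
pose e (m : R) := expR (- (1098 / 1000 / m)).
have sq (a b m n : R) : b <= a * a -> 0 <= a -> 0 < n -> m = 2 * n ->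
    a <= e m -> b <= e n.
  move=> ba a0 n0 -> ae; apply: (le_trans ba).
  rewrite /e (_ : - (_ / n) = - (1098 / 1000 / (2 * n)) - 1098 / 1000 / (2 * n)).
    by rewrite expRD; apply: ler_pM.
  by field; rewrite gt_eqF.
have h0 : d 999 463 867 <= e 2048.
  by apply: le_trans (expR_ge1Dx _); rewrite /d; lra.
have {h0}h1 : d 998 928 21 <= e 1024 by apply: sq h0; rewrite /d; lra.
have {h1}h2 : d 997 857 191 <= e 512 by apply: sq h1; rewrite /d; lra.
have {h2}h3 : d 995 718 973 <= e 256 by apply: sq h2; rewrite /d; lra.
have {h3}h4 : d 991 456 273 <= e 128 by apply: sq h3; rewrite /d; lra.
have {h4}h5 : d 982 985 541 <= e 64 by apply: sq h4; rewrite /d; lra.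
have {h5}h6 : d 966 260 573 <= e 32 by apply: sq h5; rewrite /d; lra.
have {h6}h7 : d 933 659 494 <= e 16 by apply: sq h6; rewrite /d; lra.
have {h7}h8 : d 871 720 50 <= e 8 by apply: sq h7; rewrite /d; lra.
have {h8}h9 : d 759 895 845 <= e 4 by apply: sq h8; rewrite /d; lra.
have {h9}h10 : d 577 441 695 <= e 2 by apply: sq h9; rewrite /d; lra.
have {h10}h11 : d 333 438 911 <= e 1 by apply: sq h10; rewrite /d; lra.
move: h11; rewrite /e divr1 expRN => h; rewrite -(invrK (expR _)) -(invrK 3).
rewrite lef_pV2 ?posrE ?invr_gt0 ?expR_gt0 //; apply: le_trans h; rewrite /d; lra.
Qed.

Lemma sieve_block (V N : nat) : (2 ^ (4 * V ^ 40) <= N)%N ->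
  exists2 v, (V <= v)%N & (2 ^ (4 * v ^ 40) <= N < 2 ^ (4 * v.+1 ^ 40))%N.
Proof.
move=> VN.
have vle v : (2 ^ (4 * v ^ 40) <= N)%N -> (v <= N)%N.
  apply: leq_trans; apply: ltnW; apply: leq_trans (ltn_expl v (isT : 1 < 2)%N) _.
  rewrite leq_exp2l //; case: v => // v.
  by rewrite -[leqLHS]mul1n leq_mul // -{1}[v.+1]expn1 leq_pexp2l.
have [v hv hmax] := ex_maxnP (ex_intro _ V VN) vle.
exists v; first exact: hmax.
by rewrite hv ltnNge; apply/negP => /hmax; rewrite ltnn.
Qed.

(** Every large [N] lies in a block given by [sieve_block], whose index [v] tends to infinity with
    [N]. *)
Lemma cvg_blocks (u : nat -> R) (C : R) :
  (forall v N, (1 < v)%N -> (2 ^ (4 * v ^ 40) <= N < 2 ^ (4 * v.+1 ^ 40))%N ->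
    1 - C / v%:R <= u N <= 1) ->
  u N @[N --> \oo] --> (1 : R).
Proof.
move=> hu; apply/cvgrPdist_le => e e0.
pose V := (Num.truncn (`|C| / e)).+2; have V0 : 0 < V%:R :> R by rewrite ltr0n.
have Ve : `|C| / V%:R <= e.
  rewrite ler_pdivrMr // mulrC -ler_pdivrMr // ltW //.
  by apply: lt_trans (Num.Theory.truncnS_gt _) _; rewrite ltr_nat.
near=> N.
have VN : (2 ^ (4 * V ^ 40) <= N)%N by near: N; exact: nbhs_infty_ge.
have [v Vv hv] := sieve_block VN.
have /andP[ul u1] := hu v N (leq_trans (isT : 1 < V)%N Vv) hv.
rewrite ger0_norm ?subr_ge0 //; apply: le_trans Ve.
apply: le_trans (_ : C / v%:R <= _); first lra.
apply: le_trans (ler_norm _) _; rewrite normrM normfV (ger0_norm (ler0n _ v)) //.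
rewrite ler_wpM2l // lef_pV2 ?posrE ?ler_nat // ltr0n; exact: leq_trans Vv.
Unshelve. all: by end_near.
Qed.

Lemma count_upto_ord (A : set nat) N : ~ A 0%N ->
  count_upto A N = (\sum_(n < N.+1) ((n : nat) \in A))%N.
Proof.
move=> A0; rewrite -(big_mkord xpredT (fun n => nat_of_bool (n \in A))).
rewrite big_ltn //= memNset // add0n /count_upto big_mkcond /=.
by apply: eq_bigr => n _; case: (n \in A).
Qed.

Lemma in_primes n : (n \in [set p | prime p]) = prime n.
Proof. by apply/idP/idP => [/set_mem|h] //; apply/mem_set. Qed.

Lemma count_primesE N :
  count_upto [set p | prime p] N = size (primes_to N).
Proof.
rewrite /count_upto /primes_to size_filter -sum1_count.
by apply: eq_bigl => n; exact: in_primes.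
Qed.

Lemma count_primes_ge N : (2 <= N)%N ->
  N%:R / 6 <= (count_upto [set p | prime p] N)%:R * ln N%:R :> R.
Proof.
move=> N2; rewrite count_primesE.
have n0 : (0 < N %/ 2)%N by lia.
have nN : (2 * (N %/ 2) <= N)%N by lia.
have h3 : N%:R <= 3 * (N %/ 2)%:R :> R by rewrite -natrM ler_nat; lia.
have := size_primes_to_ge R n0; move: (N %/ 2)%N n0 nN h3 => n n0 nN h3 h.
apply: le_trans (_ : n%:R / 2 <= _); first lra.
apply: (le_trans h); apply: ler_pM => //.
- by rewrite ln_ge0 // ler1n; lia.
- rewrite ler_nat /primes_to; apply: uniq_leq_size.
    by rewrite filter_uniq // iota_uniq.
  move=> p; rewrite !mem_filter !mem_index_iota => /and3P[-> -> /=].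
  by rewrite !ltnS => /leq_trans; apply.
- by rewrite ler_ln ?posrE ?ltr0n ?ler_nat //; lia.
Qed.

(** For [n > 1] this is [(ln n)^(ln 3 / 2)], the bound of (ii) and (iii) with zero error terms. *)
Definition target (n : nat) : R := expR (ln 3%:R / 2%:R * loglog R n).

(** [v + 1 <= 2 v] gives [ln N <= 4 (2 v)^40]; then [4 <= e^2] and [2^40 <= e^40] make up the 42. *)
Lemma ln_block v N : (1 < v)%N -> (0 < N)%N -> (N < 2 ^ (4 * v.+1 ^ 40))%N ->
  ln (N%:R : R) <= expR (40 * ln v%:R + 42).
Proof.
move=> v1 N0 Nv; have v0 : (0 < v)%N := ltnW v1.
have l21 : ln (2 : R) <= 1 by have := @le_ln1Dx R 1; rewrite -[1 + 1]/2; apply; lra.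
apply: le_trans (_ : (4 * (2 * v) ^ 40)%:R <= _); last first.
  have e2 : 2 <= expR 1 :> R by have := expR_ge1Dx (1 : R); lra.
  rewrite (_ : 40 * ln v%:R + 42 = 1 + 1 + 40%:R * 1 + 40 * ln v%:R); last by ring.
  rewrite !expRD expRM_natl (expR_lnM_natr R 40 v0) natrM natrX natrM exprMn mulrA.
  rewrite ler_wpM2r // ler_pM // ?lerXn2r ?nnegrE ?expR_ge0 //.
  by rewrite (_ : 4 = 2 * 2 :> R) ?ler_pM //; ring.
have : (v.+1 ^ 40 <= (2 * v) ^ 40)%N.
  by rewrite leq_exp2r // mul2n -addnn -addn1 leq_add2l.
move: Nv; move: (v.+1 ^ 40)%N ((2 * v) ^ 40)%N => a b Na ab.
apply: le_trans (_ : ln (2 ^ (4 * a))%:R <= _).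
  by rewrite ler_ln ?posrE ?ltr0n ?ler_nat ?expn_gt0 // ltnW.
rewrite natrX lnXn // -[ln _ *+ _]mulr_natl.
apply: le_trans (_ : (4 * a)%:R <= _); first by rewrite ler_piMr.
by rewrite ler_nat leq_mul2l.
Qed.

Lemma ln_ge1 n : (2 < n)%N -> 1 <= ln (n%:R : R).
Proof.
move=> n3; apply: le_trans (_ : ln 3 <= _); first by have := ln3_ge; lra.
by rewrite ler_ln ?posrE ?ltr0n ?ler_nat //; lia.
Qed.

(** The threshold is 1 more than half the bound [40 ln v + 42] for [ln ln n]; this 1 pays for
    [w.-1]. *)
Lemma target_le v n w : (1 < v)%N -> (2 < n)%N -> (n < 2 ^ (4 * v.+1 ^ 40))%N ->
  omega_threshold R v < w%:R -> target n <= (3 ^ w.-1)%:R.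
Proof.
move=> v1 n3 nv tw; have n0 : (0 < n)%N by apply: leq_trans n3.
have l1 := ln_ge1 n3.
have llv : loglog R n <= 40 * ln v%:R + 42.
  by rewrite -[leRHS](@expRK R) ler_ln ?posrE ?expR_gt0 ?ln_block //; lra.
have lv0 : 0 <= ln (v%:R : R) by rewrite ln_ge0 // ler1n ltnW.
have l3 := ln3_ge.
have w0 : (0 < w)%N.
  by rewrite -(ltr0n R); apply: lt_trans tw; rewrite /omega_threshold; lra.
have wE : w%:R = w.-1%:R + 1 :> R by rewrite natr1 prednK.
rewrite /target natrX -[3 ^+ _](@lnK R) ?posrE ?exprn_gt0 // ler_expR lnXn //.
rewrite -[ln _ *+ _]mulr_natr -mulrA ler_wpM2l //; first lra.
by move: tw; rewrite wE /omega_threshold; lra.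
Qed.

(** [0.549 = 1.098 / 2], so [ln3_ge] suffices. The factor 1 is the constant [K] of the theorem. *)
Lemma target_ge (n : nat) : (2 < n)%N ->
  ln n%:R `^ (549%:R / 1000%:R) <= 1 * target n.
Proof.
move=> n3; have l1 := ln_ge1 n3; have l3 := ln3_ge.
rewrite mul1r -[in leLHS](@lnK R (ln n%:R)) ?posrE; last lra.
rewrite -expRM /target ler_expR mulrC ler_wpM2r //; last lra.
exact: ln_ge0.
Qed.

(** In every case the prime factors of [n] itself in the sieve range are used; the factor [q] that
    is [2 mod 3] enters when [n] is [1 mod 4] and prime to 3. *)
Lemma es_count_unexceptional v n : (0 < n)%N -> ~~ exceptional R v n ->
  (3 ^ (omega v n).-1 <= es_count n)%N.
Proof.
move=> n0; rewrite negb_or negbK => /andP[_ /hasP[q]].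
move=> /sieve_primesP[pq q3 _] /andP[/eqP q2 qn].
pose S := [seq l <- sieve_primes v | l %| n]%N.
have uS : uniq S by rewrite filter_uniq // sieve_primes_uniq.
have pS : all (fun l => prime l && (3 < l)%N) S.
  by apply/allP => l; rewrite mem_filter => /andP[_ /sieve_primesP[-> ->]].
have pS' : all prime S by apply: sub_all pS => l /andP[].
have hS : {in S, forall l, l %| n}%N by move=> l; rewrite mem_filter => /andP[].
have hS' m : {in S, forall l, l %| n * m}%N by move=> l /hS ln; rewrite dvdn_mulr.
have sS : size S = omega v n by rewrite size_filter.
rewrite -sS; have le1 : (3 ^ (size S).-1 <= 3 ^ size S)%N by rewrite leq_exp2l // leq_pred.
have [on|en] := boolP (odd n); last by apply: leq_trans le1 _; exact: es_count_even.
have [n4|n4] := eqVneq (n %% 4)%N 3%N.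
  by apply: leq_trans le1 _; exact: es_count_3mod4.
have [d3|d3] := boolP (3 %| n)%N; first by apply: leq_trans le1 _; exact: es_count_dvd3.
apply: (@es_count_1mod4 n q) => //; last by rewrite dvdn_mulr.
- by move: on n4; clear; lia.
- exact: ltnW.
Qed.

(** As [p] has a single prime factor, the divisors come from [p + 1] or [p + 3], according to
    [p mod 4]. *)
Lemma es_count_unexceptional_prime v p : prime p -> (3 < p)%N ->
  ~~ exceptional_prime R v p ->
  exists2 w, omega_threshold R v < w%:R & (3 ^ w.-1 <= es_count p)%N.
Proof.
move=> pp p3; rewrite /exceptional_prime pp /= !negb_or -!ltNge negbK.
move=> /and3P[t1 t3 /hasP[q /sieve_primesP[pq q3 _] /andP[/eqP q2 qp]]].
have op : odd p by case: (even_prime pp) => // p2; rewrite p2 in p3.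
pose S m := [seq l <- sieve_primes v | l %| m]%N.
have uS m : uniq (S m) by rewrite filter_uniq // sieve_primes_uniq.
have pS m : all (fun l => prime l && (3 < l)%N) (S m).
  by apply/allP => l; rewrite mem_filter => /andP[_ /sieve_primesP[-> ->]].
have hS m : {in S m, forall l, l %| p * m}%N.
  by move=> l; rewrite mem_filter => /andP[lm _]; rewrite dvdn_mull.
have sS m : size (S m) = omega v m by rewrite size_filter.
have [p4|p4] := eqVneq (p %% 4)%N 3%N.
  exists (omega v (p + 1)) => //; rewrite -sS.
  apply: leq_trans (es_count_3mod4 p4 (uS _) (pS _) (hS _)).
  by rewrite leq_exp2l // leq_pred.
exists (omega v (p + 3)) => //; rewrite -sS.
apply: (@es_count_1mod4 p q) => //.
- by move: op p4; clear; lia.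
- by rewrite dvdn_prime2 //; apply: contraTneq p3 => <-.
- exact: ltnW.
- by rewrite dvdn_mull.
Qed.

End Density.

(** * Densities *)

Section RelativeDensity.
Variable R : realType.

Lemma sum_ltn_leq k M : (\sum_(n < M) ((n : nat) < k) <= k)%N.
Proof.
suff -> : (\sum_(n < M) ((n : nat) < k) = minn M k)%N by exact: geq_minr.
elim: M => [|M IH]; first by rewrite big_ord0 min0n.
by rewrite big_ord_recr /= IH; case: ltnP; lia.
Qed.

Lemma count_upto_le (A B : set nat) N : A `<=` B ->
  (count_upto A N <= count_upto B N)%N.
Proof.
move=> AB; rewrite /count_upto big_mkcond [leqRHS]big_mkcond /=.
apply: leq_sum => n _; case: ifP => // /set_mem/AB nB.
by rewrite (mem_set nB).
Qed.

Lemma count_upto_leq_nat (A : set nat) N : (count_upto A N <= N)%N.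
Proof.
rewrite /count_upto big_mkcond /=.
apply: leq_trans (_ : \sum_(1 <= n < N.+1) 1 <= _)%N.
  by apply: leq_sum => n _; case: ifP.
by rewrite sum_nat_const_nat muln1 subn1.
Qed.

Lemma leq_block v : (v <= 2 ^ (4 * v ^ 40))%N.
Proof.
apply: ltnW; apply: leq_trans (ltn_expl v (isT : 1 < 2)%N) _.
rewrite leq_exp2l //; case: v => // v.
by rewrite -[leqLHS]mul1n leq_mul // -{1}[v.+1]expn1 leq_pexp2l.
Qed.

(** The primes up to the sieve level thus number at most [N / v^41], against at least a constant
    times [N / v^40] primes up to [N]. *)
Lemma sieve_level_block v : (1 < v)%N ->
  (sieve_level v * v ^ 41 <= 2 ^ (4 * v ^ 40))%N.
Proof.
move=> v1; have v0 : (0 < v)%N := ltnW v1.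
have h41 : (41 <= v ^ 39)%N.
  apply: (@leq_trans (2 ^ 6)) => //; apply: (@leq_trans (v ^ 6)).
    by rewrite leq_exp2r.
  by rewrite leq_pexp2l.
apply: leq_trans (_ : 2 ^ (v ^ 39) * (2 ^ v) ^ 41 <= _)%N.
  by rewrite leq_mul2l leq_exp2r // (ltnW (ltn_expl v _)) ?orbT.
rewrite -expnM -expnD leq_exp2l // (expnSr v 39).
by move: h41 v0; move: (v ^ 39)%N => m; clear; nia.
Qed.

(** [2 < n] ensures [ln n >= 1], so [loglog] is neither negative nor a default value. *)
Definition good : set nat :=
  [set n | (2 < n)%N /\ target R n <= (es_count n)%:R].

Lemma good_unexceptional v n : (1 < v)%N -> (2 < n)%N ->
  (n < 2 ^ (4 * v.+1 ^ 40))%N -> ~~ exceptional R v n -> good n.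
Proof.
move=> v1 n2 nv ex; split=> //.
have n0 : (0 < n)%N by apply: leq_trans n2.
apply: le_trans (_ : (3 ^ (omega v n).-1)%:R <= _).
  apply: target_le nv _ => //.
  by move: ex; rewrite negb_or -ltNge => /andP[].
by rewrite ler_nat; apply: es_count_unexceptional ex.
Qed.

Lemma count_good v N : (1 < v)%N -> (N < 2 ^ (4 * v.+1 ^ 40))%N ->
  (N <= count_upto good N + 2 + \sum_(n < N.+1) exceptional R v n)%N.
Proof.
move=> v1 Nv; rewrite count_upto_ord; last by case.
(* The count runs over the [N + 1] integers from 0 to [N]; discarding the three below 3 gives the 2
   of the statement. *)
rewrite -ltnS -[X in (X <= _)%N]muln1 -[X in (X * _)%N](card_ord N.+1) -sum_nat_const.
apply: leq_trans (_ : \sum_(n < N.+1) (((n : nat) \in good) + ((n : nat) < 3) +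
   exceptional R v n) <= _)%N; last first.
  rewrite !big_split /=; have := sum_ltn_leq 3 N.+1.
  by move: (\sum_(n < _) _)%N (\sum_(n < _) _)%N (\sum_(n < _) _)%N; clear; lia.
apply: leq_sum => n _; have [n3|n3] := ltnP n 3; first by rewrite addnAC addn1.
have [ex|ex] := boolP (exceptional R v n); first by rewrite addn1.
rewrite mem_set //; apply: good_unexceptional ex => //.
by apply: leq_trans Nv; rewrite ltnS -ltnS.
Qed.

Lemma density_one_good : density_one R good.
Proof.
have [C C0 hC] := count_exceptional R.
apply: (@cvg_blocks _ _ (2 + 2 * C)) => v N v1 /andP[vN Nv].
have v0 : (0 < v)%N := ltnW v1.
have vlN : (v <= N)%N := leq_trans (leq_block v) vN.
have N0 : 0 < N%:R :> R by rewrite ltr0n (leq_trans v0).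
have v0R : 0 < v%:R :> R by rewrite ltr0n.
apply/andP; split; last by rewrite ler_pdivrMr // mul1r ler_nat count_upto_leq_nat.
have h := count_good v1 Nv.
have hx := hC v N.+1 v1 (leq_trans vN (leqnSn N)).
rewrite ler_pdivlMr //.
have e3 : expR (- (3 * ln v%:R)) <= v%:R^-1 :> R.
  rewrite -[v%:R^-1](@lnK R) ?posrE ?invr_gt0 // ler_expR lnV ?posrE //.
  have : 0 <= ln (v%:R : R) by rewrite ln_ge0 // ler1n.
  lra.
have hN : (N%:R : R) <= (count_upto good N)%:R + 2 +
    (\sum_(n < N.+1) exceptional R v n)%:R.
  by rewrite -!natrD ler_nat.
have N2 : N.+1%:R <= 2 * N%:R :> R.
  by rewrite -natrM ler_nat mul2n -addnn -addn1 leq_add2l (leq_trans v0).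
have t1 : C * N.+1%:R * expR (- (3 * ln v%:R)) <= 2 * C * (N%:R / v%:R).
  rewrite mulrA; apply: ler_pM; rewrite ?expR_ge0 ?mulr_ge0 ?(ltW C0) //.
  by rewrite [leRHS]mulrAC [leRHS]mulrC ler_wpM2l // ltW.
have t2 : 1 <= N%:R / v%:R :> R by rewrite ler_pdivlMr // mul1r ler_nat.
rewrite mulrBl mul1r mulrAC -mulrA.
move: hx hN t1 t2; set x := N%:R / v%:R; set c := (count_upto _ _)%:R.
by set s := (\sum_(n < _) _)%:R; nra.
Qed.

Definition good_primes : set nat := [set p | prime p /\ good p].

Lemma count_good_primes v N : (1 < v)%N -> (N < 2 ^ (4 * v.+1 ^ 40))%N ->
  (count_upto [set p | prime p] N <= count_upto good_primes N +
    (sieve_level v).+1 +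
    \sum_(n < N.+1 | (sieve_level v < n)%N) exceptional_prime R v n)%N.
Proof.
move=> v1 Nv; rewrite !count_upto_ord; [|by case|by []].
rewrite [X in (_ + X)%N]big_mkcond /=; set z := sieve_level v.
apply: leq_trans (_ : \sum_(n < N.+1) (((n : nat) \in good_primes) +
   ((n : nat) < z.+1) + if (z < n)%N then exceptional_prime R v n : nat else 0) <= _)%N;
  last first.
  by rewrite !big_split /= leq_add2r leq_add2l sum_ltn_leq.
apply: leq_sum => n _; rewrite in_primes; case: (boolP (prime n)) => // pn.
case: ltnP => [nz|zn]; first by rewrite addn1.
rewrite addn0; case: (boolP (exceptional_prime R v n)) => [|ex].
  by rewrite addn1.
rewrite addn0 mem_set //; split=> //.
have n3 : (3 < n)%N by apply: leq_ltn_trans (ltnW (sieve_level_ge4 v1)) _.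
split; first exact: ltnW.
have [w tw hw] := es_count_unexceptional_prime pn n3 ex.
apply: le_trans (_ : (3 ^ w.-1)%:R <= _); last by rewrite ler_nat.
apply: target_le tw => //; first exact: ltnW.
by apply: leq_trans Nv; rewrite ltnS -ltnS.
Qed.

(** At most [(2 + 2 C) N / v^41] primes are discarded, and there are at least [N / (6 e^42 v^40)]
    primes up to [N] by [count_primes_ge] and [ln_block]; the quotient is [O(1/v)]. *)
Lemma relative_density_one_good_primes :
  relative_density_one R good_primes [set p | prime p].
Proof.
have [C C0 hC] := count_exceptional_prime R.
apply: (@cvg_blocks _ _ (6 * expR 42 * (2 + 2 * C))) => v N v1 /andP[vN Nv].
have v0 : (0 < v)%N := ltnW v1.
have vlN : (v <= N)%N := leq_trans (leq_block v) vN.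
have N0 : (0 < N)%N := leq_trans v0 vlN.
have N2 : (2 <= N)%N := leq_trans v1 vlN.
have v0R : 0 < v%:R :> R by rewrite ltr0n.
have N0R : 0 < N%:R :> R by rewrite ltr0n.
have hpi := count_primes_ge R N2; have hln := ln_block R v1 N0 Nv.
have hx := hC v N.+1 v1 (leq_trans vN (leqnSn N)).
have h := count_good_primes v1 Nv.
have hz := leq_trans (sieve_level_block v1) vN.
have cBP : (count_upto good_primes N <= count_upto [set p | prime p] N)%N.
  by apply: count_upto_le => p [].
set cP := count_upto [set p | prime p] N in hpi h cBP *.
set cB := count_upto good_primes N in h cBP *.
set s := (\sum_(n < N.+1 | _) _)%N in hx h.
have z1 : (0 < sieve_level v)%N by rewrite expn_gt0.
set z := sieve_level v in hz z1 h.
have lv0 : 0 <= ln (v%:R : R) by rewrite ln_ge0 // ler1n.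
have E0 := expR_gt0 (40 * ln (v%:R : R)).
set e := expR (40 * ln (v%:R : R)) in E0.
have e42 : 0 < expR 42 :> R := expR_gt0 _.
have P1 : N%:R / 6 <= cP%:R * (e * expR 42) :> R.
  by apply: (le_trans hpi); rewrite ler_wpM2l // -expRD.
have P0 : 0 < cP%:R :> R.
  rewrite ltr0n lt0n; apply/eqP => cP0; move: P1; rewrite cP0 mul0r.
  by rewrite leNgt divr_gt0.
apply/andP; split; last by rewrite ler_pdivrMr // mul1r ler_nat.
rewrite ler_pdivlMr // mulrBl mul1r lerBlDr.
have hR : (cP%:R : R) <= cB%:R + z.+1%:R + s%:R by rewrite -!natrD ler_nat.
apply: (le_trans hR); rewrite -addrA lerD2l.
have f0 : 0 < N%:R / (e * v%:R) :> R by rewrite divr_gt0 ?mulr_gt0.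
apply: le_trans (_ : (2 + 2 * C) * (N%:R / (e * v%:R)) <= _).
  rewrite mulrDl; apply: lerD.
    rewrite mulrA ler_pdivlMr ?mulr_gt0 //.
    have -> : e * v%:R = v%:R ^+ 41.
      by rewrite /e (expR_lnM_natr R 40 v0) -exprSr.
    rewrite -natrX -!natrM ler_nat.
    apply: leq_trans (_ : 2 * (z * v ^ 41) <= _)%N; last by rewrite leq_mul2l.
    rewrite mulnA leq_mul2r; apply/orP; right.
    by rewrite mul2n -addnn -addn1 leq_add2l.
  apply: (le_trans hx); rewrite -[2 * C * _]mulrA mulrCA -[C * _ * _]mulrA.
  rewrite ler_wpM2l ?(ltW C0) // mulrA; apply: ler_pM => //.
    by rewrite -natrM ler_nat mul2n -addnn -addn1 leq_add2l.
  rewrite /e -[X in (_ * X)^-1](@lnK R v%:R) ?posrE // -expRD -expRN ler_expR.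
  lra.
have -> : 6 * expR 42 * (2 + 2 * C) / v%:R * cP%:R =
   (2 + 2 * C) * (6 * (cP%:R * (e * expR 42)) / (e * v%:R)).
  by field; rewrite !gt_eqF.
rewrite ler_wpM2l ?addr_ge0 ?mulr_ge0 ?(ltW C0) //.
rewrite ler_pM2r ?invr_gt0 ?mulr_gt0 //; lra.
Qed.

End RelativeDensity.

Theorem theorem1p8 (R : realType) :
  [/\ exists2 eps : nat -> R, eps n @[n --> \oo] --> (0 : R) &
        infinite_set [set n : nat | (0 < n)%N /\
          expR ((ln 3%:R + eps n) * (ln n%:R / loglog R n))
            <= (es_count n)%:R],
      exists C K : R, forall xi : nat -> R, xi n @[n --> \oo] --> +oo ->
        exists (A : set nat) (E : nat -> R),
          [/\ A `<=` [set n | (0 < n)%N],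
              density_one R A &
              forall n : nat, A n ->
                let main := expR (ln 3%:R / 2%:R * loglog R n - E n) in
                [/\ `|E n| <= C * `|xi n * Num.sqrt (loglog R n)|,
                    main <= (es_count n)%:R &
                    ln n%:R `^ (549%:R / 1000%:R) <= K * main]] &
      exists (B : set nat) (eps : nat -> R) (K : R),
        [/\ B `<=` [set p | prime p],
            relative_density_one R B [set p | prime p],
            eps p @[p --> \oo] --> (0 : R) &
            forall p : nat, B p ->
              let main := expR ((ln 3%:R / 2%:R - eps p) * loglog R p) in
              main <= (es_count p)%:R /\
              ln p%:R `^ (549%:R / 1000%:R) <= K * main]].
Proof.
split.
- exact: eps_pow_primorial.
(* With [E = 0], the constant [C = 0] serves every [xi], and [target_ge] gives [K = 1]. *)
- exists 0, 1 => xi _; exists (good R), (fun=> 0); split.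
  + by move=> n [/ltnW/ltnW].
  + exact: density_one_good.
  + move=> n [n2 gn]; rewrite /= subr0; split=> //; last exact: target_ge.
    by rewrite normr0 mul0r.
- exists (good_primes R), (fun=> 0), 1; split.
  + by move=> p [].
  + exact: relative_density_one_good_primes.
  + exact: cvg_cst.
  + move=> p [pp [p2 gp]]; rewrite /= subr0; split=> //; exact: target_ge.
Qed.
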